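(* Let $M$ be a closed manifold and $X=-\mathrm{grad}_g(f)$ a Morse--Bott--Smale vector field on $M$. Then the space $\hat{\mathcal T}$ of unparameterized, possibly broken trajectories of $X$ is compact.
   Context: Let $f:M\to\mathbb R$ be smooth with critical set $\Sigma$. The Hessian is $H(Y,Z)=Y\cdot df(Z)$ on $TM|_\Sigma$. $f$ is Morse--Bott if $\Sigma$ is a closed submanifold and $H$ is non-degenerate on $N=TM|_\Sigma/T\Sigma$. A metric $g$ is compatible with $f$ if there are an $H$-orthogonal splitting $N=N^+\oplus N^-$ with $\pm H|_{N^\pm}>0$, a metric on $\Sigma$, linear connections on $N^\pm$ with $H|_{N^\pm}$ parallel, and a tubular neighborhood $\varphi:N\to M$ of $\Sigma$ such that near the zero section $\varphi^*df=d(\frac12H(Y,Y))$ and $\varphi^*g$ is the metric on the total space of $N$ determined by the metric on $\Sigma$ (horizontal part), $H|_{N^+}\oplus(-H|_{N^-})$ (vertical part), horizontal $\perp$ vertical. Let $X=-\mathrm{grad}_gf$ with flow $\phi_t$. For a connected component $S\subseteq\Sigma$ let $W^\pm_S=\{x:\lim_{t\to\pm\infty}\phi_t(x)\in S\}$ (smooth submanifolds), $p_\pm:W^\pm_S\to S$ the limit maps (smooth fiber bundles), $W^-_x$ the fiber of $p_-$ over $x$. $(f,g)$ is a Morse--Bott--Smale pair, and $X$ a Morse--Bott--Smale vector field, if $g$ is compatible with $f$ and $W^-_x$ is transversal to $W^+_S$ for all $x\in\Sigma$ and all $S$. For components $S\neq S'$ let $\mathcal T(S,S')=(W^-_S\cap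 W^+_{S'})/\mathbb R$ (quotient by the flow), $\mathcal T=\bigsqcup_{S\ne S'}\mathcal T(S,S')$, with starting-point map $\pi_-:\mathcal T\to\Sigma$ and end-point map $\pi_+:\mathcal T\to\Sigma$. For $k\ge0$, $\hat{\mathcal T}_k=\mathcal T\times_\Sigma\cdots\times_\Sigma\mathcal T$ ($k+1$ factors; consecutive elements $t_i,t_{i+1}$ satisfy $\pi_+(t_i)=\pi_-(t_{i+1})$), $\hat{\mathcal T}=\bigsqcup_{k\ge0}\hat{\mathcal T}_k$; $\hat\pi_-$ (resp. $\hat\pi_+$) is $\pi_-$ of the first (resp. $\pi_+$ of the last) factor, and $\hat{\mathcal T}(S,S')=\hat\pi_-^{-1}(S)\cap\hat\pi_+^{-1}(S')$. Topology: put $a=f(S')$, $b=f(S)$; an element of $\hat{\mathcal T}(S,S')$ is regarded as a continuous path $\sigma:[a,b]\to M$ parametrized by $f$, i.e. $f(\sigma(t))=a+b-t$; $\hat{\mathcal T}(S,S')$ carries the topology induced from $C^0([a,b],M)$, and $\hat{\mathcal T}$ is topologized as the disjoint union of the $\hat{\mathcal T}(S,S')$. *)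

(* Defs.v *)
From HB Require Import structures.
From mathcomp Require Import all_boot all_order all_algebra.
From mathcomp Require Import all_classical all_reals all_analysis.
Import Order.TTheory GRing.Theory Num.Theory.
Import numFieldNormedType.Exports.

Set Implicit Arguments.
Unset Strict Implicit.
Unset Printing Implicit Defensive.

Local Open Scope classical_set_scope.
Local Open Scope ring_scope.

Section Smooth_maps.
Context {R : realType}.

Fixpoint Ck (k : nat) {V W : normedModType R} (U : set V) (F : V -> W) : Prop :=
  match k with
  | 0%N => forall x, U x -> {for x, continuous F}
  | k'.+1 => (forall x, U x -> differentiable F x) /\
             forall v, Ck k' U (fun x => 'D_v F x)
  end.

(* Meant for open U. *)
Definition smooth_on {V W : normedModType R} (U : set V) (F : V -> W) : Prop :=
  forall k, Ck k U F.

Definition smooth_at {V W : normedModType R} (F : V -> W) (x : V) : Prop :=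
  exists2 U, open_nbhs x U & smooth_on U F.

End Smooth_maps.

Record chart (R : realType) (M : topologicalType) (n : nat) := Chart {
  cdom : set M;
  cmap : M -> 'rV[R]_n;
  cinv : 'rV[R]_n -> M;
  cdom_open : open cdom;
  cim_open : open (cmap @` cdom);
  cmapK : forall x, cdom x -> cinv (cmap x) = x;
  cmap_continuous : forall x, cdom x -> {for x, continuous cmap};
  cinv_continuous : forall x, cdom x -> {for cmap x, continuous cinv} }.

Definition smooth_transition (R : realType) (M : topologicalType) (n : nat)
    (c d : chart R M n) : Prop :=
  smooth_on (cmap c @` (cdom c `&` cdom d)) (cmap d \o cinv c).

(* A smooth atlas, indexed by the points of M so that every point comes with a
   preferred chart around it. *)
Record smooth_structure (R : realType) (M : topologicalType) (n : nat) :=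
  SmoothStructure {
    chart_at : M -> chart R M n;
    mem_chart_at : forall x, cdom (chart_at x) x;
    chart_at_smooth : forall x y, smooth_transition (chart_at x) (chart_at y) }.

Section Manifold.
Context {R : realType} {M : topologicalType} {n : nat}.
Variable A : smooth_structure R M n.

(* The tangent space T_x M is 'rV[R]_n: a tangent vector at x is recorded by its
   components in the preferred chart at x.  The next two functions convert
   these components to and from the components in another chart c around x. *)
Definition tcoord (c : chart R M n) (x : M) (v : 'rV[R]_n) : 'rV[R]_n :=
  'D_v (cmap c \o cinv (chart_at A x)) (cmap (chart_at A x) x).

Definition tvec (c : chart R M n) (x : M) (w : 'rV[R]_n) : 'rV[R]_n :=
  'D_w (cmap (chart_at A x) \o cinv c) (cmap c x).

Definition smooth_fun_at (h : M -> R) (x : M) : Prop :=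
  smooth_at (h \o cinv (chart_at A x) : 'rV[R]_n -> R^o)
            (cmap (chart_at A x) x).

Definition smooth_fun (h : M -> R) : Prop := forall x, smooth_fun_at h x.

Definition dfun (h : M -> R) (x : M) (v : 'rV[R]_n) : R :=
  'D_v (h \o cinv (chart_at A x) : 'rV[R]_n -> R^o) (cmap (chart_at A x) x).

Definition smooth_field_at (s : M -> 'rV[R]_n) (x : M) : Prop :=
  let c := chart_at A x in
  smooth_at (fun p => tcoord c (cinv c p) (s (cinv c p))) (cmap c x).

Definition smooth_field (s : M -> 'rV[R]_n) : Prop :=
  forall x, smooth_field_at s x.

Definition bilinear_symmetric (P : set 'rV[R]_n)
    (b : 'rV[R]_n -> 'rV[R]_n -> R) : Prop :=
  (forall k u v w, P u -> P v -> P w -> b (k *: u + v) w = k * b u w + b v w) /\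
  (forall u v, P u -> P v -> b u v = b v u).

Definition riemannian_metric (g : M -> 'rV[R]_n -> 'rV[R]_n -> R) : Prop :=
  (forall x, bilinear_symmetric setT (g x)) /\
  (forall x v, v != 0 -> 0 < g x v v) /\
  (forall x v w, let c := chart_at A x in
    smooth_at (fun p => g (cinv c p) (tvec c (cinv c p) v)
                                     (tvec c (cinv c p) w) : R^o)
              (cmap c x)).

Definition is_gradient (g : M -> 'rV[R]_n -> 'rV[R]_n -> R) (f : M -> R)
    (Y : M -> 'rV[R]_n) : Prop :=
  forall x v, g x (Y x) v = dfun f x v.

Definition velocity (gam : R^o -> M) : 'rV[R]_n :=
  'D_1 (cmap (chart_at A (gam 0)) \o gam) 0.

(* Smoothness of a curve near the parameter 0. *)
Definition smooth_curve (gam : R^o -> M) : Prop :=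
  (\forall t \near (0 : R^o), cdom (chart_at A (gam 0)) (gam t)) /\
  smooth_at (cmap (chart_at A (gam 0)) \o gam) 0.

Definition is_flow (X : M -> 'rV[R]_n) (phi : R -> M -> M) : Prop :=
  [/\ forall x, phi 0 x = x,
      forall s t x, phi (s + t) x = phi s (phi t x),
      continuous (fun p : R^o * M => phi p.1 p.2) &
      forall x, is_derive (0 : R^o) 1 (fun t : R^o => cmap (chart_at A x) (phi t x))
                          (X x)].

Definition curve_in (B : set M) (x : M) (u : 'rV[R]_n) (gam : R^o -> M) : Prop :=
  [/\ smooth_curve gam, gam 0 = x, velocity gam = u &
      \forall t \near (0 : R^o), B (gam t)].

Definition tangent (B : set M) (x : M) : set 'rV[R]_n :=
  [set u | exists gam, curve_in B x u gam].

(* The dimension may vary with the component. *)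
Definition closed_submanifold (B : set M) : Prop :=
  closed B /\
  forall x, B x -> exists (c : chart R M n) (k : nat),
    [/\ cdom c x,
        forall y, smooth_transition c (chart_at A y) /\
                  smooth_transition (chart_at A y) c &
        forall y, cdom c y ->
          (B y <-> forall j : 'I_n, (k <= j)%N -> cmap c y ord0 j = 0)].

Definition smooth_along (B : set M) (h : M -> R) : Prop :=
  forall x, B x -> exists2 h' : M -> R, smooth_fun_at h' x &
    \forall y \near x, B y -> h y = h' y.

(* [P] is a smooth subbundle of the restriction of TM to [B]. *)
Definition smooth_subbundle (B : set M) (P : M -> set 'rV[R]_n) : Prop :=
  forall x, B x -> exists (m : nat) (e : 'I_m -> M -> 'rV[R]_n),
    (forall i, smooth_field_at (e i) x) /\
    \forall y \near x, B y ->
      (forall v, P y v <-> exists a : 'I_m -> R, v = \sum_i a i *: e i y) /\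
      (forall a : 'I_m -> R, \sum_i a i *: e i y = 0 -> forall i, a i = 0).

Definition transversal_at (B C : set M) (y : M) : Prop :=
  forall v, exists u w, [/\ tangent B y u, tangent C y w & v = u + w].

Definition crit (f : M -> R) : set M := [set x | forall v, dfun f x v = 0].

(* H(u, v) = u . df(V), where V is the extension of v that is constant in the
   preferred chart at x; only used at critical points, where the choice of the
   extension does not matter. *)
Definition hess (f : M -> R) (x : M) (u v : 'rV[R]_n) : R :=
  'D_u (fun p => 'D_v (f \o cinv (chart_at A x) : 'rV[R]_n -> R^o) p : R^o)
       (cmap (chart_at A x) x).

(* Non-degeneracy on N_x = T_x M / T_x Sigma says that the radical of H_x
   is contained in T_x Sigma (the other inclusion always holds). *)
Definition morse_bott (f : M -> R) : Prop :=
  closed_submanifold (crit f) /\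
  forall x, crit f x -> forall u, (forall v, hess f x u v = 0) ->
    tangent (crit f) x u.

Section Compatible_metrics.
Variables (f : M -> R) (g : M -> 'rV[R]_n -> 'rV[R]_n -> R).

Local Notation Sig := (crit f).
Local Notation TSig := (tangent Sig).
Local Notation H := (hess f).

(* The normal bundle N = TM|_Sigma / T Sigma is handled through representatives
   in TM|_Sigma: elements of N_x are vectors at x modulo [eqN x], and a
   subbundle of N is given by its preimage in TM|_Sigma, a subbundle [P]
   containing T Sigma.  As Sigma is a closed submanifold, the sections of
   subbundles and the smooth functions on Sigma are the restrictions of smooth
   vector fields and smooth functions on M. *)
Definition eqN (x : M) (v w : 'rV[R]_n) : Prop := TSig x (v - w).

Definition normal_subbundle (P : M -> set 'rV[R]_n) : Prop :=
  smooth_subbundle Sig P /\ forall x, Sig x -> TSig x `<=` P x.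

Definition section_of (P : M -> set 'rV[R]_n) (s : M -> 'rV[R]_n) : Prop :=
  smooth_field s /\ forall x, Sig x -> P x (s x).

Definition H_splitting (Pp Pm : M -> set 'rV[R]_n) : Prop :=
  [/\ normal_subbundle Pp, normal_subbundle Pm,
      forall x, Sig x ->
        (forall v, exists u w, [/\ Pp x u, Pm x w & v = u + w]) /\
        (forall v, Pp x v -> Pm x v -> TSig x v),
      forall x u w, Sig x -> Pp x u -> Pm x w -> H x u w = 0 &
      forall x u, Sig x -> ~ TSig x u ->
        (Pp x u -> 0 < H x u u) /\ (Pm x u -> H x u u < 0)].

Definition metric_on_crit (h : M -> 'rV[R]_n -> 'rV[R]_n -> R) : Prop :=
  [/\ forall x, Sig x -> bilinear_symmetric (TSig x) (h x),
      forall x u, Sig x -> TSig x u -> u != 0 -> 0 < h x u u &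
      forall U V, section_of TSig U -> section_of TSig V ->
        smooth_along Sig (fun x => h x (U x) (V x))].

(* [nab s x u] represents the covariant derivative of the section [s] of the
   subbundle [P] of N in the direction u of T_x Sigma. *)
Definition linear_connection (P : M -> set 'rV[R]_n)
    (nab : (M -> 'rV[R]_n) -> M -> 'rV[R]_n -> 'rV[R]_n) : Prop :=
  (forall s x u, section_of P s -> Sig x -> TSig x u -> P x (nab s x u)) /\
  (forall s s' x u, section_of P s -> section_of P s' ->
    (forall y, Sig y -> eqN y (s y) (s' y)) -> Sig x -> TSig x u ->
    eqN x (nab s x u) (nab s' x u)) /\
  (forall s x k u v, section_of P s -> Sig x -> TSig x u -> TSig x v ->
    eqN x (nab s x (k *: u + v)) (k *: nab s x u + nab s x v)) /\
  (forall s s' x u, section_of P s -> section_of P s' -> Sig x -> TSig x u ->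
    eqN x (nab (fun y => s y + s' y) x u) (nab s x u + nab s' x u)) /\
  (forall h s x u, smooth_fun h -> section_of P s -> Sig x -> TSig x u ->
    eqN x (nab (fun y => h y *: s y) x u)
          (dfun h x u *: s x + h x *: nab s x u)) /\
  (forall s U, section_of P s -> section_of TSig U ->
    exists2 s', section_of P s' &
      forall x, Sig x -> eqN x (nab s x (U x)) (s' x)).

Definition H_parallel (P : M -> set 'rV[R]_n)
    (nab : (M -> 'rV[R]_n) -> M -> 'rV[R]_n -> 'rV[R]_n) : Prop :=
  forall s s' x u gam, section_of P s -> section_of P s' -> Sig x ->
    curve_in Sig x u gam ->
    is_derive (0 : R^o) 1
      (fun t : R^o => H (gam t) (s (gam t)) (s' (gam t)) : R^o)
      (H x (nab s x u) (s' x) + H x (s x) (nab s' x u)).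

(* A property holds near (x, v) in TM; the components of v in the preferred
   chart at x are v itself. *)
Definition near_TM (x : M) (v : 'rV[R]_n) (Q : M -> 'rV[R]_n -> Prop) : Prop :=
  let c := chart_at A x in
  nbhs (cmap c x, v) [set q | Q (cinv c q.1) (tvec c (cinv c q.1) q.2)].

(* Smoothness of a map from TM|_Sigma to M at (x, v). *)
Definition smooth_from_TM_at (psi : M -> 'rV[R]_n -> M) (x : M) (v : 'rV[R]_n) :
    Prop :=
  let c := chart_at A x in let d := chart_at A (psi x v) in
  exists2 F : 'rV[R]_n * 'rV[R]_n -> 'rV[R]_n, smooth_at F (cmap c x, v) &
    nbhs (cmap c x, v) [set q |
      let y := cinv c q.1 in let w := tvec c y q.2 in
      Sig y -> cdom d (psi y w) /\ cmap d (psi y w) = F q].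

(* Smoothness at z of the map z |-> (pr z, nu z) from M to TM. *)
Definition smooth_to_TM_at (pr : M -> M) (nu : M -> 'rV[R]_n) (z : M) : Prop :=
  let c := chart_at A (pr z) in let d := chart_at A z in
  (\forall y \near z, cdom c (pr y)) /\
  smooth_at (fun p => (cmap c (pr (cinv d p)),
                       tcoord c (pr (cinv d p)) (nu (cinv d p)))) (cmap d z).

(* [psi] induces a map N -> M which is a diffeomorphism onto an open set, is the
   inclusion on the zero section, and whose differential along the zero section
   induces the identity of N. *)
Definition tubular_neighborhood (psi : M -> 'rV[R]_n -> M) : Prop :=
  [/\ forall x v w, Sig x -> eqN x v w -> psi x v = psi x w,
      forall x v, Sig x -> smooth_from_TM_at psi x v,
      forall x, Sig x -> psi x 0 = x,
      forall x v, Sig x -> eqN x (velocity (fun t => psi x (t *: v))) v &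
      exists (O : set M) (pr : M -> M) (nu : M -> 'rV[R]_n),
        [/\ open O,
            forall x v, Sig x ->
              [/\ O (psi x v), pr (psi x v) = x & eqN x (nu (psi x v)) v],
            forall z, O z -> Sig (pr z) /\ psi (pr z) (nu z) = z &
            forall z, O z -> smooth_to_TM_at pr nu z]].

(* psi^* df = d (1/2 H(Y, Y)) at the point (x, v) of N, evaluated on the tangent
   vector to N given by an arbitrary curve (gam t, Y t) through (x, v). *)
Definition pullback_df_at (psi : M -> 'rV[R]_n -> M) (x : M) (v : 'rV[R]_n) :
    Prop :=
  forall (gam : R^o -> M) (Y : R^o -> 'rV[R]_n),
    smooth_curve gam -> gam 0 = x -> (\forall t \near (0 : R^o), Sig (gam t)) ->
    smooth_at (fun t => tcoord (chart_at A x) (gam t) (Y t)) 0 -> Y 0 = v ->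
    'D_1 (fun t : R^o => f (psi (gam t) (Y t)) : R^o) 0 =
    'D_1 (fun t : R^o => 2^-1 * H (gam t) (Y t) (Y t) : R^o) 0.

Section Pullback_metric.
Variables (psi : M -> 'rV[R]_n -> M) (Pp Pm : M -> set 'rV[R]_n).
Variables (nabp nabm : (M -> 'rV[R]_n) -> M -> 'rV[R]_n -> 'rV[R]_n).

Definition vertical_image (x : M) (v w : 'rV[R]_n) : 'rV[R]_n :=
  velocity (fun t => psi x (v + t *: w)).

(* [xi] is the image under the differential of psi of the horizontal lift of u
   to T_(x, v) N: the derivative along u of a section s = sp + sm of N through
   (x, v) with vanishing covariant derivative in the direction u. *)
Definition horizontal_image (x : M) (v u xi : 'rV[R]_n) : Prop :=
  exists gam sp sm,
    [/\ curve_in Sig x u gam,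
        section_of Pp sp /\ section_of Pm sm,
        eqN x (sp x + sm x) v,
        eqN x (nabp sp x u) 0 /\ eqN x (nabm sm x u) 0 &
        xi = velocity (fun t => psi (gam t) (sp (gam t) + sm (gam t)))].

Definition pullback_metric_at (h : M -> 'rV[R]_n -> 'rV[R]_n -> R)
    (x : M) (v : 'rV[R]_n) : Prop :=
  [/\ forall u u' xi xi',
        horizontal_image x v u xi -> horizontal_image x v u' xi' ->
        g (psi x v) xi xi' = h x u u',
      forall wp wm wp' wm', Pp x wp -> Pm x wm -> Pp x wp' -> Pm x wm' ->
        g (psi x v) (vertical_image x v (wp + wm))
                    (vertical_image x v (wp' + wm')) =
        H x wp wp' - H x wm wm' &
      forall u xi w, horizontal_image x v u xi ->
        g (psi x v) xi (vertical_image x v w) = 0].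

End Pullback_metric.

Definition compatible_metric : Prop :=
  exists (Pp Pm : M -> set 'rV[R]_n) (h : M -> 'rV[R]_n -> 'rV[R]_n -> R)
    (nabp nabm : (M -> 'rV[R]_n) -> M -> 'rV[R]_n -> 'rV[R]_n)
    (psi : M -> 'rV[R]_n -> M),
    [/\ H_splitting Pp Pm,
        metric_on_crit h,
        (linear_connection Pp nabp /\ H_parallel Pp nabp) /\
        (linear_connection Pm nabm /\ H_parallel Pm nabm),
        tubular_neighborhood psi &
        forall x, Sig x -> near_TM x 0 (fun y v => Sig y ->
          pullback_df_at psi y v /\
          pullback_metric_at psi Pp Pm nabp nabm h y v)].

End Compatible_metrics.

Section Trajectories.
Variables (f : M -> R) (phi : R -> M -> M).

Local Notation Sig := (crit f).

Definition crit_component (S : set M) : Prop :=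
  exists2 x, Sig x & S = connected_component Sig x.

Definition Wminus (S : set M) : set M :=
  [set x | exists2 p, S p & phi t x @[t --> -oo] --> p].

Definition Wplus (S : set M) : set M :=
  [set x | exists2 p, S p & phi t x @[t --> +oo] --> p].

Definition Wminus_fiber (x : M) : set M :=
  [set y | phi t y @[t --> -oo] --> x].

Definition morse_bott_smale (g : M -> 'rV[R]_n -> 'rV[R]_n -> R) : Prop :=
  [/\ morse_bott f, compatible_metric f g &
      forall x S, Sig x -> crit_component S ->
        forall y, Wminus_fiber x y -> Wplus S y ->
          transversal_at (Wminus_fiber x) (Wplus S) y].

Definition flow_orbit (x : M) : set M := [set phi t x | t in [set: R]].

Definition trajectories : set (set M) :=
  [set O | exists S S' x, [/\ crit_component S, crit_component S', S <> S',
    Wminus S x /\ Wplus S' x & O = flow_orbit x]].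

Definition start_point (O : set M) (p : M) : Prop :=
  exists2 x, O = flow_orbit x & phi t x @[t --> -oo] --> p.

Definition end_point (O : set M) (p : M) : Prop :=
  exists2 x, O = flow_orbit x & phi t x @[t --> +oo] --> p.

Lemma trajectory_start (O : trajectories) : exists p, start_point (set_val O) p.
Proof.
have : trajectories (set_val O) by apply/set_mem; exact: valP.
by case=> S [S'] [x] [_ _ _ [[p _ xp] _] ->]; exists p, x.
Qed.

Lemma trajectory_end (O : trajectories) : exists p, end_point (set_val O) p.
Proof.
have : trajectories (set_val O) by apply/set_mem; exact: valP.
by case=> S [S'] [x] [_ _ _ [_ [p _ xp]] ->]; exists p, x.
Qed.

(* The starting-point and end-point maps (limits are unique when M is
   Hausdorff and phi is a flow). *)
Definition pi_minus (O : trajectories) : M := projT1 (cid (trajectory_start O)).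

Definition pi_plus (O : trajectories) : M := projT1 (cid (trajectory_end O)).

Definition broken_trajectories_k (k : nat) : set ('I_k.+1 -> trajectories) :=
  [set tau | forall i : 'I_k,
    pi_plus (tau (widen_ord (leqnSn k) i)) = pi_minus (tau (lift ord0 i))].

Definition broken_trajectory : Type :=
  {k : nat & @broken_trajectories_k k}.

HB.instance Definition _ := gen_eqMixin broken_trajectory.
HB.instance Definition _ := gen_choiceMixin broken_trajectory.

Definition nbreaks (tau : broken_trajectory) : nat := projT1 tau.

Definition piece (tau : broken_trajectory) : 'I_(nbreaks tau).+1 -> trajectories :=
  set_val (projT2 tau).

Definition hat_pi_minus (tau : broken_trajectory) : M :=
  pi_minus (@piece tau ord0).

Definition hat_pi_plus (tau : broken_trajectory) : M :=
  pi_plus (@piece tau ord_max).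

(* The pair (S, S') with tau in hat T(S, S'). *)
Definition end_components (tau : broken_trajectory) : set M * set M :=
  (connected_component Sig (hat_pi_minus tau),
   connected_component Sig (hat_pi_plus tau)).

(* The constant value f(S). *)
Definition level (S : set M) : R := get (f @` S).

Definition broken_image (tau : broken_trajectory) : set M :=
  \bigcup_(i in [set: 'I_(nbreaks tau).+1])
    (set_val (@piece tau i) `|` [set pi_minus (@piece tau i); pi_plus (@piece tau i)]).

Definition path_interval (SS : set M * set M) : set R :=
  `[level SS.2, level SS.1].

(* The path sigma : [a, b] -> M parametrized by f: sigma t is the point of the
   broken trajectory at which f takes the value a + b - t.  The default value of
   [xget] is irrelevant, as there is exactly one such point. *)
Definition broken_path (tau : broken_trajectory) :
    path_interval (end_components tau) -> M :=
  fun t => xget (hat_pi_minus tau)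
    [set y | broken_image tau y /\
      f y = level (end_components tau).2 + level (end_components tau).1
            - set_val t].

(* The disjoint union, over the pairs (S, S'), of the spaces of maps
   [f(S'), f(S)] -> M.  On continuous maps the compact-open topology is the
   C^0 topology. *)
Definition path_space : Type :=
  {SS : set M * set M & {compact-open, path_interval SS -> M}}.

HB.instance Definition _ := Topological.on path_space.

Definition to_path_space (tau : broken_trajectory) : path_space :=
  existT _ (end_components tau) (@broken_path tau).

(* hat T(S, S') carries the topology induced from C^0([f(S'), f(S)], M), and
   hat T the disjoint union topology. *)
Definition broken_trajectory_space : Type := initial_topology to_path_space.

HB.instance Definition _ := Topological.on broken_trajectory_space.

End Trajectories.
End Manifold.

(* Main.v *)
Require Import Defs.
From mathcomp Require Import all_boot all_order all_algebra.
From mathcomp Require Import all_classical all_reals all_analysis.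
From mathcomp Require Import ring lra.
Import Order.TTheory GRing.Theory Num.Theory.
Import numFieldNormedType.Exports.

(* A limit of broken trajectories can only fail to be broken if the paths,
   parametrized by f, are not equicontinuous.  Away from Sigma equicontinuity
   is clear.  Near p in Sigma, Morse-Bott non-degeneracy gives the Lojasiewicz
   inequality |f - f(p)| <= K |X|^2: transversally to Sigma, df grows at least
   linearly and f at most quadratically.  Hence the length of a piece of
   trajectory near p is bounded by a multiple of the variation of
   sqrt |f - f(p)|, and a small variation of f forces a small displacement.
   So an ultrafilter of broken trajectories converges, level by level, to a
   continuous path.  Outside Sigma this path follows the flow, and it meets
   Sigma only at the isolated critical levels; hence it is a broken trajectory. *)

Set Implicit Arguments.
Unset Strict Implicit.
Unset Printing Implicit Defensive.
Local Open Scope classical_set_scope.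
Local Open Scope ring_scope.

(** * Directional derivatives *)

Section Calculus.
Context {R : realType}.

(** Orbits take infinite time to reach Sigma, so continuity of the flow in time says nothing there:
    the control must be by f alone. This is the content of [gl_trap]: an orbit that passes close
    enough to p lies in U wherever f is within dl of f(p), whatever the elapsed time. A broken
    trajectory consists of several orbits, but in a window of levels around f(p) containing no other
    critical value it breaks at most once, so two nested traps suffice. No bound on the number of
    breaks is prepared in advance. The breaks of the limit path are found as consecutive critical
    levels: since critical values are isolated, a nonempty set of critical levels contains its
    infimum and its supremum, so a level not reached by finitely many orbits would have a least
    example, which one more orbit then reaches. The limit argument sees only the topological
    interface [gradient_like], and it handles broken trajectories through their images ([chain]). As
    f is injective on such an image, a point is determined by its level. *)

Lemma is_derive_curve (V W : normedModType R) (F : V -> W) (gam : R^o -> V)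
    (t : R^o) (w : V) :
  is_derive t 1 gam w -> differentiable F (gam t) ->
  is_derive t 1 (F \o gam) ('D_w F (gam t)).
Proof.
move=> [dg <-] dF.
have dg' : differentiable gam t by apply/derivable1_diffP.
have dFg : differentiable (F \o gam) t by exact: differentiable_comp.
apply: DeriveDef; first exact/derivable1_diffP.
by rewrite deriveE // diff_comp //= deriveE // [in RHS]deriveE.
Qed.

Lemma derive_comp (U V W : normedModType R) (F : V -> W) (L : U -> V) x v :
  differentiable L x -> differentiable F (L x) ->
  'D_v (F \o L) x = 'D_('D_v L x) F (L x).
Proof.
move=> dL dF.
have dFL : differentiable (F \o L) x by exact: differentiable_comp.
by rewrite deriveE // diff_comp //= !deriveE.
Qed.

Lemma deriveZr (V W : normedModType R) (F : V -> W) x (k : R) v :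
  differentiable F x -> 'D_(k *: v) F x = k *: 'D_v F x.
Proof. by move=> dF; rewrite !deriveE // linearZ. Qed.

Lemma derive_row (W : normedModType R) n (F : 'rV[R]_n -> W) x v :
  differentiable F x ->
  'D_v F x = \sum_j v ord0 j *: 'D_('e_j) F x.
Proof.
move=> dF; rewrite {1}(row_sum_delta v) deriveE // linear_sum.
by apply: eq_bigr => j _; rewrite linearZ /= deriveE.
Qed.

Lemma mean_value_seg (V : normedModType R) (F : V -> R^o) x v :
  (forall s, 0 <= s <= 1 -> differentiable F (x + s *: v)) ->
  exists2 s, 0 <= s <= 1 & F (x + v) - F x = 'D_v F (x + s *: v).
Proof.
move=> dF; pose gam (t : R^o) : V := x + t *: v.
have dgam (t : R^o) : is_derive t 1 gam v.
  have dl : differentiable (fun u : R^o => u *: v) t by exact: differentiableZl.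
  have il : is_derive t 1 (fun u : R^o => u *: v) v.
    apply: DeriveDef; first exact/derivable1_diffP.
    by rewrite deriveE // diffZl //= diff_val scale1r.
  by have := is_deriveD (is_derive_cst x t 1) il; rewrite add0r.
have dFg (t : R^o) : 0 <= t <= 1 ->
    is_derive t 1 (F \o gam) ('D_v F (gam t)).
  by move=> t01; apply: is_derive_curve => //; exact: dF.
have [] := @MVT_segment R (F \o gam) (fun t => 'D_v F (gam t)) 0 1 ler01.
- by move=> t; rewrite in_itv /= => /andP[t0 t1]; apply: dFg; rewrite !ltW.
- apply: derivable_within_continuous => t; rewrite in_itv /= => t01.
  by have [] := dFg t t01.
move=> s; rewrite in_itv /= => s01.
by rewrite /gam /= scale1r scale0r addr0 subr0 mulr1 => e; exists s.
Qed.

Lemma coord_le_norm n (v : 'rV[R]_n) j : `|v ord0 j| <= `|v|.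
Proof.
rewrite [leRHS]/Num.norm /= mx_normrE.
exact: (le_bigmax _ (fun ij => `|v ij.1 ij.2|) (ord0, j)).
Qed.

Lemma norm_row_le n (v : 'rV[R]_n) (e : R) : 0 <= e ->
  (forall j, `|v ord0 j| <= e) -> `|v| <= e.
Proof.
move=> e0 ve; rewrite [leLHS]/Num.norm /= mx_normrE.
by apply/bigmax_leP; split=> // -[i j] _ /=; rewrite (ord1 i).
Qed.

Definition C1_at (V W : normedModType R) (F : V -> W) (x : V) : Prop :=
  (\forall y \near x, differentiable F y) /\
  forall v, {for x, continuous (fun y => 'D_v F y)}.

Lemma smooth_at_derive (V W : normedModType R) (F : V -> W) x v :
  smooth_at F x -> smooth_at (fun y => 'D_v F y) x.
Proof. by move=> [U oU sF]; exists U => // k; have [_ ] := sF k.+1; exact. Qed.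

Lemma smooth_at_C1 (V W : normedModType R) (F : V -> W) x :
  smooth_at F x -> C1_at F x.
Proof.
move=> [U [oU Ux] sF]; split.
  have [dF _] := sF 1%N.
  by apply: filterS dF _; exact: open_nbhs_nbhs.
by move=> v; have [_ /(_ v)] := sF 1%N; exact.
Qed.

Lemma C1_at_differentiable (V W : normedModType R) (F : V -> W) x :
  C1_at F x -> differentiable F x.
Proof. by move=> [/nbhs_singleton]. Qed.

Lemma C1_at_continuous (V W : normedModType R) (F : V -> W) x :
  C1_at F x -> {for x, continuous F}.
Proof. by move=> /C1_at_differentiable; exact: differentiable_continuous. Qed.

(** Linearity in the direction reduces joint convergence in the base point and the direction to the
    finitely many ['e_j]. The joint form is what compactness of a sphere of directions requires. *)
Lemma C1_at_derive_cvg (W : normedModType R) n (F : 'rV[R]_n -> W) x v :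
  C1_at F x -> 'D_p.2 F p.1 @[p --> (x, v)] --> 'D_v F x.
Proof.
move=> CF; have [dF cF] := CF.
rewrite (derive_row _ (C1_at_differentiable CF)).
have H : (\sum_j (p : 'rV[R]_n * 'rV[R]_n).2 ord0 j *: 'D_('e_j) F p.1) @[p --> (x, v)]
    --> \sum_j v ord0 j *: 'D_('e_j) F x.
  apply: cvg_big => [|j _]; first exact: add_continuous.
  apply: cvgZ.
    apply: (@cvg_comp _ _ _ snd (fun w : 'rV[R]_n => w ord0 j)).
      exact: cvg_snd.
    exact: coord_continuous.
  by apply: (@cvg_comp _ _ _ fst (fun y => 'D_('e_j) F y) _ (nbhs x));
    [exact: cvg_fst|exact: cF].
apply: cvg_trans H; apply: near_eq_cvg.
have : \forall p \near (x, v), differentiable F p.1.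
  exact: (@cvg_fst _ _ (nbhs x) (nbhs v) _ _ dF).
by apply: filterS => p dp; rewrite -derive_row.
Qed.

Lemma C1_at_comp (V W : normedModType R) n (F : 'rV[R]_n -> W)
    (L : V -> 'rV[R]_n) x :
  C1_at L x -> C1_at F (L x) -> C1_at (F \o L) x.
Proof.
move=> CL CF.
have near_d : \forall y \near x, differentiable L y /\ differentiable F (L y).
  near=> y; split; near: y; first by case: CL.
  exact: (C1_at_continuous CL (proj1 CF)).
split; first by apply: filterS near_d => y [? ?]; exact: differentiable_comp.
move=> v; rewrite /prop_for /continuous_at.
rewrite derive_comp; [|exact: C1_at_differentiable..].
have H : 'D_('D_v L y) F (L y) @[y --> x] --> 'D_('D_v L x) F (L x).
  have cL : (L y, 'D_v L y) @[y --> x] --> (L x, 'D_v L x).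
    exact: (cvg_pair (C1_at_continuous CL) (proj2 CL v)).
  have := @C1_at_derive_cvg _ _ _ _ ('D_v L x) CF.
  exact: (@cvg_comp _ _ _ _ (fun p => 'D_p.2 F p.1) _ _ _ cL).
apply: cvg_trans H; apply: near_eq_cvg.
apply: filterS near_d => y [dL dFL]; rewrite -derive_comp.
Unshelve. all: by end_near. Qed.

Lemma continuous_near_bounded (T : topologicalType) (W : normedModType R)
    (F : T -> W) x :
  {for x, continuous F} -> exists2 K : R, 0 < K & \forall y \near x, `|F y| <= K.
Proof.
move=> cF; exists (`|F x| + 1); first by rewrite ltr_wpDl.
have /cvgrPdist_lt /(_ 1 ltr01) := cF; apply: filterS => y.
rewrite distrC => h; rewrite -[F y](subrK (F x)) addrC.
by rewrite (le_trans (ler_normD _ _)) // lerD2l ltW.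
Qed.

Lemma C1_at_derive_bounded (W : normedModType R) n (F : 'rV[R]_n -> W) x :
  C1_at F x -> exists2 K : R, 0 < K &
    \forall y \near x, forall v, `|'D_v F y| <= K * `|v|.
Proof.
move=> [dF cF].
have /choice[K HK] : forall j : 'I_n, exists K : R, 0 < K /\
    \forall y \near x, `|'D_('e_j) F y| <= K.
  move=> j; have [K K0 HK] := continuous_near_bounded (cF 'e_j).
  by exists K.
(* The summand 1 keeps the constant positive even for [n] = 0. *)
exists (\sum_j K j + 1).
  by rewrite ltr_wpDl // sumr_ge0 // => j _; have [/ltW] := HK j.
have nK : \forall y \near x, forall j, `|'D_('e_j) F y| <= K j.
  exact: (@filter_forall _ _ (fun j y => `|'D_('e_j) F y| <= K j) (nbhs x) _ (fun j => proj2 (HK j))).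
near=> y => v.
have dy : differentiable F y by near: y.
rewrite derive_row // (le_trans (ler_norm_sum _ _ _)) //.
rewrite mulrDl mul1r -[leLHS]addr0 lerD // mulr_suml.
apply: ler_sum => j _; rewrite normrZ mulrC ler_pM //; last exact: coord_le_norm.
by move: j; near: y.
Unshelve. all: by end_near. Qed.

End Calculus.

(** * Charts and flows *)

Section Charts.
Context {R : realType} {M : topologicalType} {n : nat}.
Variable A : smooth_structure R M n.

(** [cinv c] is arbitrary off the image of the chart; as this image is open, it is a genuine inverse
    near [cmap c y]. Statements in coordinates are brought back to M in this way. *)
Lemma near_cinv (c : chart R M n) y (U : set M) : cdom c y -> nbhs y U ->
  \forall q \near cmap c y,
    [/\ cdom c (cinv c q), U (cinv c q) & cmap c (cinv c q) = q].
Proof.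
move=> cy Uy.
have H1 : \forall q \near cmap c y, (cmap c @` cdom c) q.
  by apply: open_nbhs_nbhs; split; [exact: cim_open|exists y].
have H2 : \forall q \near cmap c y, U (cinv c q).
  by have := cinv_continuous cy; rewrite /prop_for /continuous_at cmapK //; exact.
by apply: filterS2 H1 H2 => _ [z cz <-]; rewrite cmapK.
Qed.

Lemma near_cmap (c : chart R M n) y (U : set 'rV[R]_n) : cdom c y ->
  nbhs (cmap c y) U -> \forall z \near y, cdom c z /\ U (cmap c z).
Proof.
move=> cy Uy; have H1 : \forall z \near y, cdom c z.
  by apply: open_nbhs_nbhs; split => //; exact: cdom_open.
exact: (filterI H1 (cmap_continuous cy Uy)).
Qed.

Lemma transition_smooth_at (c d : chart R M n) y : smooth_transition c d ->
  cdom c y -> cdom d y -> smooth_at (cmap d \o cinv c) (cmap c y).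
Proof.
move=> cd cy dy; exists (cmap c @` (cdom c `&` cdom d)) => //.
split; last by exists y.
rewrite openE => _ [z [cz dz] <-]; rewrite /interior.
have dz' : nbhs z (cdom d) by apply: open_nbhs_nbhs; split=> //; exact: cdom_open.
apply: filterS (near_cinv cz dz') => q [cq dq <-].
by exists (cinv c q).
Qed.

Lemma transitionE (c d : chart R M n) y : cdom c y ->
  (cmap d \o cinv c) (cmap c y) = cmap d y.
Proof. by move=> cy /=; rewrite cmapK. Qed.

Lemma near_transition (W : Type) (c d : chart R M n) (h : M -> W) y :
  cdom c y -> cdom d y ->
  \forall q \near cmap c y, (h \o cinv c) q
                          = ((h \o cinv d) \o (cmap d \o cinv c)) q.
Proof.
move=> cy dy.
have dy' : nbhs y (cdom d) by apply: open_nbhs_nbhs; split=> //; exact: cdom_open.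
by apply: filterS (near_cinv cy dy') => q [cq dq _] /=; rewrite (cmapK dq).
Qed.

(** Slice charts of a submanifold need not be among the preferred charts; this is the compatibility
    that [closed_submanifold] provides for them. *)
Definition compatible_chart (c : chart R M n) : Prop :=
  forall y, smooth_transition c (chart_at A y) /\ smooth_transition (chart_at A y) c.

Lemma chart_at_compatible x : compatible_chart (chart_at A x).
Proof. by move=> y; split; exact: chart_at_smooth. Qed.

Lemma derive_transitionK (c d : chart R M n) y v :
  smooth_transition c d -> smooth_transition d c -> cdom c y -> cdom d y ->
  'D_('D_v (cmap d \o cinv c) (cmap c y)) (cmap c \o cinv d) (cmap d y) = v.
Proof.
move=> cd dc cy dy.
have dcd := C1_at_differentiable (smooth_at_C1 (transition_smooth_at cd cy dy)).
have ddc := C1_at_differentiable (smooth_at_C1 (transition_smooth_at dc dy cy)).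
rewrite -[in cmap d y](transitionE d cy) -derive_comp //; last first.
  by rewrite transitionE.
rewrite -[RHS](@derive_id R _ (cmap c y)); apply: near_eq_derive.
have dy' : nbhs y (cdom d) by apply: open_nbhs_nbhs; split=> //; exact: cdom_open.
by apply: filterS (near_cinv cy dy') => q [cq dq qK] /=; rewrite (cmapK dq).
Qed.

Lemma tvecK c y w : compatible_chart c -> cdom c y ->
  tcoord A c y (tvec A c y w) = w.
Proof.
move=> cc cy; have [s1 s2] := cc y.
exact: (derive_transitionK w s1 s2 cy (mem_chart_at A y)).
Qed.

Lemma tcoordK c y w : compatible_chart c -> cdom c y ->
  tvec A c y (tcoord A c y w) = w.
Proof.
move=> cc cy; have [s1 s2] := cc y.
exact: (derive_transitionK w s2 s1 (mem_chart_at A y) cy).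
Qed.

(** [dfun] uses the preferred chart at [y], which jumps with [y]; comparing differentials at
    neighbouring points requires one fixed chart [c]. *)
Lemma dfun_chart (h : M -> R) c y v : compatible_chart c -> cdom c y ->
  differentiable (h \o cinv c : 'rV[R]_n -> R^o) (cmap c y) ->
  dfun A h y v = 'D_(tcoord A c y v) (h \o cinv c : 'rV[R]_n -> R^o) (cmap c y).
Proof.
move=> cc cy dh; have [s1 s2] := cc y; have my := mem_chart_at A y.
rewrite /dfun (near_eq_derive _ (near_transition h my cy)).
rewrite -[in RHS](transitionE c my) derive_comp //.
  exact: C1_at_differentiable (smooth_at_C1 (transition_smooth_at s2 my cy)).
by rewrite transitionE.
Qed.

Lemma smooth_fun_continuous (h : M -> R) : smooth_fun A h -> continuous h.
Proof.
move=> sh y; have my := mem_chart_at A y.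
have dh := C1_at_differentiable (smooth_at_C1 (sh y)).
have hE : (h \o cinv (chart_at A y)) (cmap (chart_at A y) y) = h y.
  by rewrite /= (cmapK my).
have H : (h \o cinv (chart_at A y) : 'rV[R]_n -> R^o) (cmap (chart_at A y) z)
     @[z --> y] --> h y.
  rewrite -hE.
  have cm := cmap_continuous my; have cd := differentiable_continuous dh.
  exact: (@cvg_comp _ _ _ _ (h \o cinv (chart_at A y)) _ _ _ cm cd).
apply: cvg_trans H; apply: near_eq_cvg.
have := open_nbhs_nbhs (conj (cdom_open (chart_at A y)) my).
by apply: filterS => z cz /=; rewrite cmapK.
Qed.

(** * Differentiation along the flow *)

Section Flow.
Variables (X : M -> 'rV[R]_n) (phi : R -> M -> M).
Hypothesis phi_flow : is_flow A X phi.

Lemma flow0 x : phi 0 x = x. Proof. by have [] := phi_flow. Qed.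

Lemma flowD s t x : phi (s + t) x = phi s (phi t x).
Proof. by have [] := phi_flow. Qed.

Lemma flow_continuous t x : {for (t, x), continuous (fun p : R^o * M => phi p.1 p.2)}.
Proof. by have [_ _ + _] := phi_flow; exact. Qed.

Lemma flow_continuous_time x : continuous (fun t : R^o => phi t x).
Proof.
move=> t; have c := @flow_continuous t x.
have cp : ((s, x) : R^o * M) @[s --> (t : R^o)] --> (t, x).
  exact: (cvg_pair cvg_id (cvg_cst x)).
exact: (@cvg_comp _ _ _ _ (fun p : R^o * M => phi p.1 p.2) _ _ _ cp c).
Qed.

Lemma flow_continuous_point t : continuous (phi t).
Proof.
move=> x; have c := @flow_continuous t x.
have cp : ((t, y) : R^o * M) @[y --> x] --> ((t : R^o), x).
  exact: (cvg_pair (cvg_cst (t : R^o)) cvg_id).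
exact: (@cvg_comp _ _ _ _ (fun p : R^o * M => phi p.1 p.2) _ _ _ cp c).
Qed.

(** [is_flow] gives the derivative only at time 0 and in the preferred chart; the group law moves it
    to time [t], the transition map to the chart [c]. *)
Lemma is_derive_flow_chart c x (t : R^o) : compatible_chart c -> cdom c (phi t x) ->
  is_derive t 1 (fun s : R^o => cmap c (phi s x))
    (tcoord A c (phi t x) (X (phi t x))).
Proof.
move=> cc cy; set y := phi t x; have my := mem_chart_at A y.
have [_ _ _ /(_ y) dy] := phi_flow; have [s1 s2] := cc y.
set G := (fun t : R^o => cmap (chart_at A y) (phi t y)) in dy.
pose L := cmap c \o cinv (chart_at A y).
have dL : differentiable L (cmap (chart_at A y) y).
  exact: C1_at_differentiable (smooth_at_C1 (transition_smooth_at s2 my cy)).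
have G0 : G 0 = cmap (chart_at A y) y by rewrite /G flow0.
have dLG : is_derive (0 : R^o) 1 (L \o G) (tcoord A c y (X y)).
  by rewrite /tcoord -G0; apply: is_derive_curve => //; rewrite G0.
have dLGs : is_derive t 1 ((L \o G) \o shift (- t)) (tcoord A c y (X y)).
  have [d1 <-] := dLG.
  have st0 : shift (- t) t = 0 by rewrite /= subrr.
  rewrite -st0; apply: is_derive_curve; first exact: is_derive_shift.
  by rewrite st0; apply/derivable1_diffP.
apply: near_eq_is_derive dLGs.
have ny : \forall s \near t, cdom (chart_at A y) (phi s x).
  exact: (flow_continuous_time (open_nbhs_nbhs (conj (cdom_open (chart_at A y)) my))).
apply: filterS ny => s /= ys.
rewrite /L /G /= -/y -flowD subrK.
by rewrite (cmapK ys).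
Qed.

Lemma is_derive_flow_fun (h : M -> R) x (t : R^o) : smooth_fun A h ->
  is_derive t 1 (fun s : R^o => h (phi s x) : R^o)
    (dfun A h (phi t x) (X (phi t x))).
Proof.
move=> sh; set y := phi t x; have my := mem_chart_at A y.
have dq := is_derive_flow_chart (chart_at_compatible y) my.
have dh : differentiable (h \o cinv (chart_at A y) : 'rV[R]_n -> R^o)
    (cmap (chart_at A y) y).
  exact: C1_at_differentiable (smooth_at_C1 (sh y)).
rewrite (dfun_chart _ (chart_at_compatible y) my dh).
have := is_derive_curve dq dh; apply: near_eq_is_derive.
have ny : \forall s \near t, cdom (chart_at A y) (phi s x).
  exact: (flow_continuous_time (open_nbhs_nbhs (conj (cdom_open (chart_at A y)) my))).
by apply: filterS ny => s /= ys; rewrite (cmapK ys).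
Qed.

End Flow.
End Charts.

(** * The Lojasiewicz inequality in coordinates *)

Section Lojasiewicz.
Context {R : realType} {n : nat}.

Lemma ball_row_near (x : 'rV[R]_n) (P : 'rV[R]_n -> Prop) :
  (\forall y \near x, P y) <-> exists2 e : R, 0 < e & forall y, `|y - x| < e -> P y.
Proof.
split=> [/nbhs_normP[e /= e0 H]|[e e0 H]].
  by exists e => // y yx; apply: H; rewrite /ball_ /= distrC.
by apply/nbhs_normP; exists e => // y; rewrite /ball_ /= distrC; exact: H.
Qed.

Lemma unit_sphere_compact (Z : set 'rV[R]_n) :
  closed Z -> compact (Z `&` [set z | `|z| = 1]).
Proof.
move=> cZ; apply: bounded_closed_compact.
  by exists 1; split; [exact: num_real|move=> x x1 z [_ /= ->]; exact: ltW].
apply: closedI => //.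
by apply: (closed_comp (f := fun z : 'rV[R]_n => `|z|) (D := [set 1])) => [z _|];
  [exact: norm_continuous|exact: closed_eq].
Qed.

(** Compactness of the unit sphere of [Z]. The local hypothesis covers all smaller [e'], so that
    finitely many local thresholds admit a common one. *)
Lemma sphere_uniform (Z : set 'rV[R]_n) (P : R -> 'rV[R]_n -> Prop) :
  closed Z ->
  (forall z, Z z -> `|z| = 1 -> exists2 e : R, 0 < e &
     forall z' e', `|z' - z| < e -> 0 < e' < e -> P e' z') ->
  exists2 e : R, 0 < e & forall z, Z z -> `|z| = 1 -> P e z.
Proof.
move=> cZ H.
have /compact_near_coveringP cvr := unit_sphere_compact cZ.
have HF : \forall e \near (0 : R)^'+, Z `&` [set z | `|z| = 1] `<=` P e.
  apply: cvr => z [Zz z1]; have [e e0 He] := H z Zz z1.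
  exists ([set z' | `|z' - z| < e], [set e' | 0 < e' < e]); last first.
    by move=> [z' e'] /= [h1 h2]; exact: He.
  split; first by apply/ball_row_near; exists e.
  near=> e' => /=; apply/andP; split; near: e'; first exact: nbhs_right_gt.
  exact: nbhs_right_lt.
have [e [e0 He]] := filter_ex (filterI (nbhs_right_gt (0 : R)) HF).
by exists e => // z Zz z1; apply: He.
Unshelve. all: by end_near. Qed.

(** [P] marks the coordinates that vanish. In a slice chart [coord_plane P] is the critical set, and
    [coord_plane (predC P)] is a complement, the transversal directions. *)
Definition coord_plane (P : pred 'I_n) : set 'rV[R]_n :=
  [set z | forall j, P j -> z ord0 j = 0].

Definition coord_proj (P : pred 'I_n) (r : 'rV[R]_n) : 'rV[R]_n :=
  \row_j (if P j then 0 else r ord0 j).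

Lemma coord_proj_plane P r : coord_plane P (coord_proj P r).
Proof. by move=> j Pj; rewrite mxE Pj. Qed.

Lemma coord_proj_compl P r : coord_plane (predC P) (r - coord_proj P r).
Proof. by move=> j /= /negbTE Pj; rewrite !mxE Pj subrr. Qed.

Lemma coord_plane_closed P : closed (coord_plane P).
Proof.
have -> : coord_plane P = \bigcap_(j in [set j | P j]) [set z | z ord0 j = 0].
  by rewrite predeqE => z; split => h j /=; exact: h.
apply: closed_bigI => j _.
apply: (closed_comp (f := fun z : 'rV[R]_n => z ord0 j) (D := [set 0])).
  by move=> z _; exact: coord_continuous.
exact: closed_eq.
Qed.

Lemma coord_plane_convex P r r' s : coord_plane P r -> coord_plane P r' ->
  coord_plane P (r + s *: (r' - r)).
Proof.
by move=> h h' j Pj; rewrite !mxE (h j Pj) (h' j Pj) subrr mulr0 addr0.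
Qed.

Lemma coord_proj_dist P r r0 : coord_plane P r0 ->
  `|coord_proj P r - r0| <= `|r - r0| /\ `|r - coord_proj P r| <= `|r - r0|.
Proof.
move=> h0; split; apply: norm_row_le => // j; rewrite !mxE.
  case: ifPn => Pj; first by rewrite h0 // subrr normr0.
  by have := coord_le_norm (r - r0) j; rewrite !mxE.
case: ifPn => Pj; last by rewrite subrr normr0.
by have := coord_le_norm (r - r0) j; rewrite !mxE (h0 j Pj).
Qed.

Lemma segment_ball (x y z : 'rV[R]_n) (e s : R) :
  `|x - z| < e -> `|y - z| < e -> 0 <= s <= 1 -> `|x + s *: (y - x) - z| < e.
Proof.
move=> hx hy /andP[s0 s1].
have -> : x + s *: (y - x) - z = (1 - s) *: (x - z) + s *: (y - z).
  by apply/rowP => j; rewrite !mxE; ring.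
have e0 : 0 < e by exact: le_lt_trans hx.
rewrite (le_lt_trans (ler_normD _ _)) // !normrZ (ger0_norm s0).
rewrite ger0_norm ?subr_ge0 //.
have [->|sn0] := eqVneq s 0; first by rewrite mul0r addr0 subr0 mul1r.
have sp : 0 < s by rewrite lt_neqAle eq_sym sn0.
have : s * `|y - z| < s * e by rewrite ltr_pM2l.
have : (1 - s) * `|x - z| <= (1 - s) * e.
  by rewrite ler_wpM2l ?subr_ge0 // ltW.
lra.
Qed.

Lemma half_le_norm_near (a x : R) : `|a - x| < `|a| / 2 -> `|a| / 2 <= `|x|.
Proof. by move=> h; have := ler_normD (a - x) x; rewrite subrK; lra. Qed.

Section statement.
Variables (F : 'rV[R]_n -> R^o) (L : 'rV[R]_n -> 'rV[R]_n) (r0 : 'rV[R]_n).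
Variable (P : pred 'I_n).
Hypotheses (CL : C1_at L r0) (sF : smooth_at F (L r0)) (r0P : coord_plane P r0).
Hypothesis crit_plane : \forall r \near r0, coord_plane P r ->
  forall v, 'D_v F (L r) = 0.
Hypothesis nondegenerate : forall z, coord_plane (predC P) z ->
  (forall v, 'D_('D_z L r0) ('D_v F) (L r0) = 0) -> z = 0.

(** In the application [L] is the transition from a slice chart to the preferred chart at a critical
    point. Points move in the slice chart, where the critical set is flat, while [v] remains a
    vector of the preferred chart, in which [hess] is defined. *)
Let J v := 'D_v F \o L : 'rV[R]_n -> R^o.

Let CJ v : C1_at (J v) r0.
Proof. by apply: C1_at_comp => //; apply/smooth_at_C1/smooth_at_derive. Qed.

Let CFL : C1_at (F \o L : _ -> R^o) r0.
Proof. by apply: C1_at_comp => //; exact: smooth_at_C1. Qed.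

(** For a unit transversal [z], non-degeneracy yields a [v] such that the derivative of [J v] along
    [z] is nonzero at [r0], hence bounded away from zero nearby; compactness of the sphere makes
    this uniform. As [J v] vanishes at the projection of [r] to the plane, the mean value theorem
    gives linear growth. The vector [v] depends on [r], which is why its norm is bounded too. *)
Lemma gradient_lower : exists2 e : R, 0 < e &
  forall r, `|r - r0| < e -> exists2 v, `|v| <= e^-1 &
    e * `|r - coord_proj P r| <= `|'D_v F (L r)|.
Proof.
have [e1 e10 H1] := (ball_row_near _ _).1 crit_plane.
have [|e e0 He] := @sphere_uniform (coord_plane (predC P))
  (fun e z => forall r s, coord_plane P r -> `|r - r0| < e -> 0 <= s ->
     `|r + s *: z - r0| < e -> exists2 v, `|v| <= e^-1 &
        e * s <= `|'D_v F (L (r + s *: z))|)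
  (@coord_plane_closed _) _.
  move=> z Zz z1.
  have [v] : exists v, 'D_('D_z L r0) ('D_v F) (L r0) != 0.
    apply: contrapT => /forallNP h.
    have z0 : z = 0 by apply: nondegenerate => // v; have /negP/negPn/eqP := h v.
    by move: z1; rewrite z0 normr0 => /esym/eqP; rewrite oner_eq0.
  set a := 'D_ _ _ _ => a0.
  have an : 0 < `|a| by rewrite normr_gt0.
  have cJ : 'D_p.2 (J v) p.1 @[p --> (r0, z)] --> a.
    have -> : a = 'D_z (J v) r0.
      rewrite /J derive_comp //; first exact: C1_at_differentiable.
      exact/C1_at_differentiable/smooth_at_C1/smooth_at_derive.
    exact: (C1_at_derive_cvg (CJ v)).
  have [[/= U1 U2] [/ball_row_near[d1 d10 Hd1] /ball_row_near[d2 d20 Hd2]] HU] :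
      \forall p \near (r0, z), `|a| / 2 <= `|'D_p.2 (J v) p.1|.
    have /cvgrPdist_lt /(_ (`|a| / 2)) := cJ.
    move=> /(_ ltac:(by rewrite divr_gt0)); apply: filterS => p.
    exact: half_le_norm_near.
  have [d3 d30 Hd3] := (ball_row_near _ _).1 (proj1 (CJ v)).
  have hpos : 0 < (`|v| + 1)^-1 by rewrite invr_gt0 ltr_wpDl.
  (* [d1] and [d2] keep the derivative above |a| / 2, [d3] keeps [J v] differentiable, and [e1]
     makes the plane critical. The last two terms give e' <= |a| / 2 and |v| <= 1 / e'. *)
  pose d := Num.min (Num.min d1 d2) (Num.min (Num.min d3 e1)
    (Num.min (`|a| / 2) (`|v| + 1)^-1)).
  have d0 : 0 < d by rewrite !lt_min d10 d20 d30 e10 divr_gt0 // hpos.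
  exists d => // z' e'; rewrite lt_min => /andP[]; rewrite lt_min => /andP[_ zz' _].
  rewrite !lt_min => /andP[e'0 /andP[/andP[e'1 e'2] /andP[/andP[e'3 e'e1] /andP[e'a e'v]]]].
  move=> r s rP rr0 s0 rs0; exists v.
    apply: (@le_trans _ _ (`|v| + 1)); first by rewrite lerDl.
    by rewrite -[leLHS]invrK lef_pV2 ?posrE // ltW.
  have ball3 (t : R) : 0 <= t <= 1 -> `|r + t *: (s *: z') - r0| < e'.
    move=> t01.
    have := segment_ball rr0 rs0 t01.
    by rewrite [r + s *: z']addrC addrK.
  have [t t01] := @mean_value_seg R _ (J v) r (s *: z')
    (fun t t01 => Hd3 _ (lt_trans (ball3 t t01) e'3)).
  rewrite /J /= (H1 r) ?subr0 //; last exact: lt_trans e'e1.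
  move=> ->; rewrite deriveZr; last exact: Hd3 _ (lt_trans (ball3 t t01) e'3).
  rewrite normrZ (ger0_norm s0) [e' * s]mulrC; apply: (ler_wpM2l s0).
  apply: (le_trans (ltW e'a)); apply: (HU (_, z')); split => /=.
    exact: (Hd1 _ (lt_trans (ball3 t t01) e'1)).
  exact: (Hd2 _ zz').
exists (Num.min e e1); first by rewrite lt_min e0.
move=> r; rewrite lt_min => /andP[rr0 _].
have [p1 p2] := coord_proj_dist r r0P.
have m0 : 0 < Num.min e e1 by rewrite lt_min e0.
have [s0|sn0] := eqVneq `|r - coord_proj P r| 0.
  by exists 0; [rewrite normr0 invr_ge0 ltW|rewrite s0 mulr0 normr_ge0].
set s := `|r - coord_proj P r| in sn0 *.
have sE : coord_proj P r + s *: (s^-1 *: (r - coord_proj P r)) = r.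
  by rewrite scalerA divff // scale1r addrC subrK.
have [|||||v v1 v2] := He (s^-1 *: (r - coord_proj P r)) _ _ (coord_proj P r) s
    (@coord_proj_plane P r).
- by move=> j Pj; rewrite mxE coord_proj_compl // mulr0.
- have s10 : 0 <= s^-1 by rewrite invr_ge0 /s.
  by rewrite normrZ (ger0_norm s10); exact: mulVf.
- exact: le_lt_trans rr0.
- exact: normr_ge0.
- by rewrite sE.
exists v.
  by rewrite (le_trans v1) // lef_pV2 ?posrE // ge_min lexx.
rewrite sE in v2; apply: le_trans v2.
by apply: (ler_wpM2r (normr_ge0 _)); rewrite ge_min lexx.
Qed.

(** The differential of [F] vanishes at the projection [r'] of [r], so it is at most linear in the
    distance along the segment from [r'] to [r]; a second use of the mean value theorem makes the
    variation of [F] quadratic. *)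
Lemma value_upper : exists2 e : R, 0 < e & exists2 K : R, 0 < K &
  forall r, `|r - r0| < e ->
    `|F (L r) - F (L r0)| <= K * `|r - coord_proj P r| ^+ 2.
Proof.
have [K1 K10 HK1] := C1_at_derive_bounded CL.
have /choice[K2 HK2] : forall j : 'I_n, exists K : R, 0 < K /\
    \forall y \near r0, forall v, `|'D_v (J 'e_j) y| <= K * `|v|.
  by move=> j; have [K K0 HK] := C1_at_derive_bounded (CJ 'e_j); exists K.
have nK2 : \forall y \near r0, forall (j : 'I_n) v,
    `|'D_v (J 'e_j) y| <= K2 j * `|v|.
  exact: (@filter_forall _ _ _ (nbhs r0) _ (fun j => proj2 (HK2 j))).
have nJ : \forall y \near r0, forall j : 'I_n, differentiable (J 'e_j) y.
  exact: (@filter_forall _ _ _ (nbhs r0) _ (fun j => proj1 (CJ 'e_j))).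
have nF : \forall y \near r0, differentiable F (L y).
  exact: (C1_at_continuous CL (proj1 (smooth_at_C1 sF))).
have [e e0 He] := (ball_row_near _ _).1 (filterI (filterI HK1 nK2)
  (filterI (filterI nJ nF) (filterI crit_plane (filterI (proj1 CFL) (proj1 CL))))).
exists e => //; exists (\sum_j K1 * K2 j + 1).
  rewrite ltr_wpDl // sumr_ge0 // => j _.
  by rewrite mulr_ge0 // ltW //; have [] := HK2 j.
move=> r rr0; set r' := coord_proj P r.
have [p1 p2] := coord_proj_dist r r0P.
have r'r0 : `|r' - r0| < e by exact: le_lt_trans rr0.
have r00 : `|r0 - r0| < e by rewrite subrr normr0.
(* The segment from [r0] to [r'] stays in the plane, where the differential vanishes. *)
have E1 : F (L r') = F (L r0).
  have bt t : 0 <= t <= 1 -> `|r0 + t *: (r' - r0) - r0| < e.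
    by move=> t01; exact: segment_ball.
  have [|t t01] := @mean_value_seg R _ (F \o L) r0 (r' - r0).
    by move=> t t01; have [_ [_ [_ [+ _]]]] := He _ (bt t t01).
  rewrite [r0 + _]addrC subrK /=.
  have [_ [[_ dF] [cP [_ dL]]]] := He _ (bt t t01).
  rewrite derive_comp // cP; last first.
    by apply: coord_plane_convex => //; exact: coord_proj_plane.
  by move=> /eqP; rewrite subr_eq0 => /eqP.
rewrite -E1; set z := r - r'.
have bt t : 0 <= t <= 1 -> `|r' + t *: z - r0| < e.
  by move=> t01; exact: segment_ball.
have [|t t01] := @mean_value_seg R _ (F \o L) r' z.
  by move=> t t01; have [_ [_ [_ [+ _]]]] := He _ (bt t t01).
rewrite {1}/z [r' + _]addrC subrK /= => ->.
set xi := r' + t *: z.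
have [[hK1 hK2] [[dJ dF] [_ [_ dL]]]] := He _ (bt t t01).
rewrite derive_comp // derive_row //.
rewrite (le_trans (ler_norm_sum _ _ _)) // mulrDl mul1r.
rewrite -[leLHS]addr0 lerD ?sqr_ge0 // mulr_suml; apply: ler_sum => j _.
rewrite normrZ.
(* [J 'e_j] vanishes at [r'], and [xi] lies within |z| of [r']. *)
have Jb : `|'D_('e_j) F (L xi)| <= K2 j * `|z|.
  have bs s : 0 <= s <= 1 -> `|r' + s *: (t *: z) - r0| < e.
    move=> s01.
    have -> : t *: z = xi - r' by rewrite /xi addrC addKr.
    by apply: segment_ball => //; exact: bt.
  have [|s s01] := @mean_value_seg R _ (J 'e_j) r' (t *: z).
    by move=> s s01; have [_ [[dJs _] _]] := He _ (bs s s01); exact: dJs.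
  have [_ [_ [cP _]]] := He _ r'r0.
  rewrite /J /= cP ?subr0; last exact: coord_proj_plane.
  rewrite -/xi => ->.
  have [[_ hs] _] := He _ (bs s s01).
  apply: le_trans (hs j _) _.
  have [K2j _] := HK2 j.
  rewrite normrZ ler_pM2l //.
  have /andP[t0 t1] := t01.
  by rewrite ger0_norm // ler_piMl.
have [K2j _] := HK2 j.
rewrite expr2 mulrACA ler_pM //.
by apply: le_trans (hK1 _); exact: coord_le_norm.
Qed.

Lemma lojasiewicz : exists2 K : R, 0 < K & \forall r \near r0,
  exists2 v, `|v| <= K & `|F (L r) - F (L r0)| <= K * `|'D_v F (L r)| ^+ 2.
Proof.
have [e1 e10 H1] := gradient_lower; have [e2 e20 [K K0 H2]] := value_upper.
(* The first term bounds [v]; the second arises from inserting the lower bound of the gradient,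
   squared, into the quadratic bound of the value. *)
exists (e1^-1 + K * (e1^-1) ^+ 2).
  by rewrite addr_gt0 ?invr_gt0 // mulr_gt0 // exprn_gt0 // invr_gt0.
apply/ball_row_near; exists (Num.min e1 e2); first by rewrite lt_min e10.
move=> r; rewrite lt_min => /andP[r1 r2].
have [v v1 v2] := H1 r r1; exists v.
  by rewrite (le_trans v1) // lerDl mulr_ge0 ?sqr_ge0 // ltW.
apply: (le_trans (H2 r r2)).
have h : `|r - coord_proj P r| <= e1^-1 * `|'D_v F (L r)|.
  by rewrite -ler_pdivrMl ?invr_gt0 // invrK.
apply: (@le_trans _ _ (K * (e1^-1) ^+ 2 * `|'D_v F (L r)| ^+ 2)).
  by rewrite -mulrA -exprMn ler_pM2l // ler_sqr ?nnegrE // mulr_ge0 // invr_ge0 ltW.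
by rewrite ler_wpM2r ?sqr_ge0 // lerDr invr_ge0 ltW.
Qed.

End statement.
End Lojasiewicz.

(** * Local estimates for the gradient field *)

Section Bilinear.
Context {R : realType} {n : nat}.
Variable b : 'rV[R]_n -> 'rV[R]_n -> R.
Hypothesis bb : bilinear_symmetric setT b.

Lemma bilinearC u v : b u v = b v u.
Proof. by apply: (proj2 bb). Qed.

Lemma bilinear0l w : b 0 w = 0.
Proof.
have := (proj1 bb) 1 0 0 w I I I; rewrite scaler0 addr0 mul1r.
by move=> /eqP; rewrite -subr_eq subrr eq_sym => /eqP.
Qed.

Lemma bilinearZl k u w : b (k *: u) w = k * b u w.
Proof. by have := (proj1 bb) k u 0 w I I I; rewrite !addr0 bilinear0l addr0. Qed.

Lemma bilinearDl u v w : b (u + v) w = b u w + b v w.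
Proof. by have := (proj1 bb) 1 u v w I I I; rewrite scale1r mul1r. Qed.

Lemma bilinearNl u w : b (- u) w = - b u w.
Proof. by rewrite -scaleN1r bilinearZl mulN1r. Qed.

Lemma bilinear_suml I (s : seq I) (a : I -> R) (u : I -> 'rV[R]_n) w :
  b (\sum_(i <- s) a i *: u i) w = \sum_(i <- s) a i * b (u i) w.
Proof.
elim: s => [|i s IH]; first by rewrite !big_nil bilinear0l.
by rewrite !big_cons bilinearDl bilinearZl IH.
Qed.

Lemma bilinear_sum2 m (a a' : 'I_m -> R) (u : 'I_m -> 'rV[R]_n) :
  b (\sum_i a i *: u i) (\sum_j a' j *: u j) =
  \sum_i \sum_j a i * a' j * b (u i) (u j).
Proof.
rewrite bilinear_suml; apply: eq_bigr => i _.
rewrite bilinearC bilinear_suml mulr_sumr; apply: eq_bigr => j _.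
by rewrite bilinearC mulrA.
Qed.

End Bilinear.

Section LocalEstimates.
Context {R : realType} {M : topologicalType} {n : nat}.
Variables (A : smooth_structure R M n) (f : M -> R).
Variables (g : M -> 'rV[R]_n -> 'rV[R]_n -> R) (X : M -> 'rV[R]_n).
Hypotheses (f_smooth : smooth_fun A f) (g_metric : riemannian_metric A g).
Hypothesis X_grad : is_gradient A g f (fun x => - X x).

Lemma metric_field_pos x : X x != 0 -> 0 < g x (X x) (X x).
Proof. by have [_ [+ _]] := g_metric; exact. Qed.

Lemma dfun_field x v : dfun A f x v = - g x (X x) v.
Proof. by rewrite -X_grad (bilinearNl ((proj1 g_metric) x)). Qed.

Lemma crit_field x : crit A f x <-> X x = 0.
Proof.
split=> [cx|X0 v]; last first.
  by rewrite dfun_field X0 (bilinear0l ((proj1 g_metric) x)) oppr0.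
apply: contrapT => /eqP /metric_field_pos.
by have := cx (X x); rewrite dfun_field => /eqP; rewrite oppr_eq0 => /eqP ->; rewrite ltxx.
Qed.

Lemma half_le_near (a x : R) : `|a - x| < a / 2 -> a / 2 <= x.
Proof. by rewrite ltr_norml => /andP[_ h]; lra. Qed.

Variable p : M.
Local Notation c := (chart_at A p).
Local Notation q0 := (cmap c p).
Local Notation F := (f \o cinv c : 'rV[R]_n -> R^o).
Let cc := chart_at_compatible A p.
Let cp : cdom c p := mem_chart_at A p.

Lemma near_cdom : \forall y \near p, cdom c y.
Proof. by apply: open_nbhs_nbhs; split => //; exact: cdom_open. Qed.

Lemma near_chart (P : 'rV[R]_n -> Prop) :
  (\forall q \near q0, P q) -> \forall y \near p, P (cmap c y).
Proof. by move=> H; have := near_cmap cp H; apply: filterS => y []. Qed.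

Lemma near_dfun_chart : \forall y \near p, forall v,
  dfun A f y v = 'D_(tcoord A c y v) F (cmap c y).
Proof.
have := near_chart (proj1 (smooth_at_C1 (f_smooth p))).
apply: filterS2 near_cdom => y cy dF v.
exact: dfun_chart.
Qed.

Lemma tvec_row y v : cdom c y ->
  tvec A c y v = \sum_j v ord0 j *: tvec A c y 'e_j.
Proof.
move=> cy; have [s1 s2] := cc y.
have := C1_at_differentiable (smooth_at_C1
  (transition_smooth_at s1 cy (mem_chart_at A y))).
by move=> dL; rewrite /tvec derive_row.
Qed.

Definition chart_metric (q : 'rV[R]_n) (v w : 'rV[R]_n) : R :=
  g (cinv c q) (tvec A c (cinv c q) v) (tvec A c (cinv c q) w).

Lemma chart_metricE y v w : cdom c y ->
  g y v w = \sum_i \sum_j (tcoord A c y v) ord0 i * (tcoord A c y w) ord0 j *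
            chart_metric (cmap c y) 'e_i 'e_j.
Proof.
move=> cy; rewrite /chart_metric (cmapK cy).
rewrite -{1}(tcoordK v cc cy) -{1}(tcoordK w cc cy).
rewrite (tvec_row _ cy) [in X in g y _ X](tvec_row _ cy).
by rewrite (bilinear_sum2 ((proj1 g_metric) y)).
Qed.

Lemma chart_metric_continuous i j :
  {for q0, continuous (fun q => chart_metric q 'e_i 'e_j : R^o)}.
Proof.
have [_ [_ /(_ p 'e_i 'e_j)]] := g_metric.
by move=> /smooth_at_C1 /C1_at_continuous.
Qed.

Lemma metric_upper : exists2 C : R, 0 < C & \forall y \near p, forall v w,
  `|g y v w| <= C * `|tcoord A c y v| * `|tcoord A c y w|.
Proof.
have /choice[K HK] : forall ij : 'I_n * 'I_n, exists K : R, 0 < K /\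
    \forall q \near q0, `|chart_metric q 'e_ij.1 'e_ij.2| <= K.
  by move=> [i j]; have [K K0 HK] :=
    continuous_near_bounded (@chart_metric_continuous i j); exists K.
have nK : \forall q \near q0, forall ij : 'I_n * 'I_n,
    `|chart_metric q 'e_ij.1 'e_ij.2| <= K ij.
  exact: (@filter_forall _ _ _ (nbhs q0) _ (fun j => proj2 (HK j))).
exists (\sum_i \sum_j K (i, j) + 1).
  rewrite ltr_wpDl // sumr_ge0 // => i _; rewrite sumr_ge0 // => j _.
  by have [/ltW] := HK (i, j).
apply: filterS2 near_cdom (near_chart nK) => y cy H v w.
rewrite (chart_metricE _ _ cy).
set a := tcoord A c y v; set a' := tcoord A c y w.
rewrite -mulrA mulrDl mul1r -[leLHS]addr0 lerD ?mulr_ge0 //.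
rewrite (le_trans (ler_norm_sum _ _ _)) // mulr_suml; apply: ler_sum => i _.
rewrite (le_trans (ler_norm_sum _ _ _)) // mulr_suml; apply: ler_sum => j _.
rewrite mulrC !normrM ler_pM // ?mulr_ge0 //; first exact: (H (i, j)).
by rewrite ler_pM // coord_le_norm.
Qed.

(** Positivity holds only vector by vector at [p]; compactness of the unit sphere of coordinate
    vectors makes it uniform near [p], and homogeneity extends it to all lengths. *)
Lemma metric_lower : exists2 C : R, 0 < C & \forall y \near p, forall v,
  C * `|tcoord A c y v| ^+ 2 <= g y v v.
Proof.
pose Q (q v : 'rV[R]_n) : R^o := \sum_(i < n) \sum_(j < n)
  v ord0 i * v ord0 j * chart_metric q 'e_i 'e_j.
have QE y v : cdom c y -> g y v v = Q (cmap c y) (tcoord A c y v).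
  exact: chart_metricE.
have QZ q k v : Q q (k *: v) = k ^+ 2 * Q q v.
  rewrite /Q mulr_sumr; apply: eq_bigr => i _; rewrite mulr_sumr.
  by apply: eq_bigr => j _; rewrite !mxE; ring.
have Qpos v : v != 0 -> 0 < Q q0 v.
  move=> v0; rewrite -(tvecK v cc cp) -QE //.
  have [_ [gp _]] := g_metric; apply: gp; apply: contraNneq v0 => t0.
  by rewrite -(tvecK v cc cp) t0 /tcoord derive0.
have Qc v : Q z.1 z.2 @[z --> (q0, v)] --> Q q0 v.
  apply: cvg_big => [|i _]; first exact: add_continuous.
  apply: cvg_big => [|j _]; first exact: add_continuous.
  have cs k : (z : 'rV[R]_n * 'rV[R]_n).2 ord0 k @[z --> (q0, v)] --> v ord0 k.
    have c1 : z.2 @[z --> (q0, v)] --> v by exact: cvg_snd.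
    exact: (@cvg_comp _ _ _ _ (fun w : 'rV[R]_n => w ord0 k) _ _ _ c1
      (@coord_continuous R 1 n ord0 k v)).
  apply: (@cvgM _ _ _ _ (fun z : 'rV[R]_n * 'rV[R]_n => z.2 ord0 i * z.2 ord0 j)
     (fun z => chart_metric z.1 'e_i 'e_j)); first by apply: cvgM; exact: cs.
  have c2 : z.1 @[z --> (q0, v)] --> q0 by exact: cvg_fst.
  exact: (@cvg_comp _ _ _ _ (fun q => chart_metric q 'e_i 'e_j) _ _ _ c2
    (@chart_metric_continuous i j)).
have [||e e0 He] := @sphere_uniform R n setT
  (fun e z => forall q, `|q - q0| < e -> e <= Q q z).
- exact: closedT.
- move=> z _ z1.
  have z0 : z != 0 by rewrite -normr_gt0 z1.
  have Qz := Qpos _ z0; have Qz2 : 0 < Q q0 z / 2 by rewrite divr_gt0.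
  have [[/= U1 U2] [/ball_row_near[d1 d10 Hd1] /ball_row_near[d2 d20 Hd2]] HU] :
      \forall r \near (q0, z), Q q0 z / 2 <= Q r.1 r.2.
    have /cvgrPdist_lt /(_ _ Qz2) := Qc z; apply: filterS => r.
    exact: half_le_near.
  exists (Num.min (Q q0 z / 2) (Num.min d1 d2)).
    by rewrite !lt_min Qz2 d10.
  move=> z' e'; rewrite !lt_min => /andP[_ /andP[_ zz']] /andP[e'0].
  move=> /andP[e'Q /andP[e'1 _]] q qe'; apply: (le_trans (ltW e'Q)).
  apply: (HU (q, z')); split; first exact: (Hd1 _ (lt_trans qe' e'1)).
  exact: (Hd2 _ zz').
exists e => //.
have nq : \forall q \near q0, `|q - q0| < e by apply/ball_row_near; exists e.
apply: filterS2 near_cdom (near_chart nq) => y cy qe v.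
rewrite (QE _ _ cy); set a := tcoord A c y v.
have [->|a0] := eqVneq a 0.
  have -> : Q (cmap c y) 0 = 0.
    by rewrite -(scale0r (0 : 'rV[R]_n)) QZ expr0n /= mul0r.
  by rewrite normr0 expr0n /= mulr0.
have an : `|a| != 0 by rewrite normr_eq0.
have aE : a = `|a| *: (`|a|^-1 *: a) by rewrite scalerA divff // scale1r.
rewrite [in leRHS]aE QZ mulrC; apply: (ler_wpM2l (sqr_ge0 _)); apply: He => //.
by rewrite normrZ ger0_norm ?invr_ge0 // mulVf.
Qed.


Local Notation W y := (tcoord A c y (X y)).

(** Since df = - g(X, .), a lower bound for the differential becomes through this a lower bound for
    the field. *)
Lemma differential_upper : exists2 C : R, 0 < C & \forall y \near p, forall w,
  `|'D_w F (cmap c y)| <= C * `|W y| * `|w|.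
Proof.
have [C C0 HC] := metric_upper; exists C => //.
apply: filterS2 near_cdom (filterI near_dfun_chart HC) => y cy [hd hg] w.
by rewrite -{1}(tvecK w cc cy) -hd dfun_field normrN -{2}(tvecK w cc cy).
Qed.

(** No regularity of [X] is assumed: it is controlled through g(X, X) = - df(X), where df vanishes
    at [p] and grows at most linearly, while g(X, X) dominates the square of the coordinate length
    of [X]. The bound serves to show that critical points are fixed by the flow. *)
Lemma field_linear_bound : crit A f p -> exists2 K : R, 0 < K &
  \forall y \near p, `|W y| <= K * `|cmap c y - q0|.
Proof.
move=> critp.
have D0 v : 'D_v F q0 = 0.
  have := critp (tvec A c p v).
  by rewrite (nbhs_singleton near_dfun_chart) tvecK.
have [C C0 HC] := metric_lower.
pose G v := 'D_v F : 'rV[R]_n -> R^o.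
have CG v : C1_at (G v) q0.
  by apply: smooth_at_C1; apply: smooth_at_derive; exact: f_smooth.
have /choice[K HK] : forall j : 'I_n, exists K : R, 0 < K /\
    \forall q \near q0, forall v, `|'D_v (G 'e_j) q| <= K * `|v|.
  by move=> j; have [K K0 HK] := C1_at_derive_bounded (CG 'e_j); exists K.
have nK : \forall q \near q0, forall (j : 'I_n) v,
    `|'D_v (G 'e_j) q| <= K j * `|v|.
  exact: (@filter_forall _ _ _ (nbhs q0) _ (fun j => proj2 (HK j))).
have nG : \forall q \near q0, forall j : 'I_n, differentiable (G 'e_j) q.
  exact: (@filter_forall _ _ _ (nbhs q0) _ (fun j => proj1 (CG 'e_j))).
have [e e0 He] := (ball_row_near _ _).1 (filterI nK nG).
have K1pos : 0 < \sum_j K j + 1.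
  by rewrite ltr_wpDl // sumr_ge0 // => j _; have [/ltW] := HK j.
exists (C^-1 * (\sum_j K j + 1)); first by rewrite mulr_gt0 // invr_gt0.
have nq : \forall q \near q0, `|q - q0| < e /\ differentiable F q.
  apply: filterI; first by apply/ball_row_near; exists e.
  exact: (proj1 (smooth_at_C1 (f_smooth p))).
have nd := near_dfun_chart.
apply: filterS2 (filterI HC nd) (near_chart nq) => y [hC hd] [ye dF].
set w := W y; set q := cmap c y in ye dF *.
have Dw : `|'D_w F q| <= (\sum_j K j + 1) * `|q - q0| * `|w|.
  rewrite derive_row // (le_trans (ler_norm_sum _ _ _)) //.
  rewrite -mulrA mulrDl mul1r -[leLHS]addr0 lerD ?mulr_ge0 // mulr_suml.
  apply: ler_sum => j _; rewrite normrZ mulrC mulrA ler_pM //; last exact: coord_le_norm.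
  have q00 : `|q0 - q0| < e by rewrite subrr normr0.
  have [|t t01] := @mean_value_seg R _ (G 'e_j) q0 (q - q0).
    by move=> t t01; have [_] := He _ (segment_ball q00 ye t01); exact.
  have G0 : G 'e_j q0 = 0 by exact: D0.
  rewrite [q0 + _]addrC subrK G0 subr0 => GE.
  have -> : 'D_('e_j) F q = 'D_(q - q0) (G 'e_j) (q0 + t *: (q - q0)) by exact: GE.
  by have [+ _] := He _ (segment_ball q00 ye t01); exact.
have := hC (X y); rewrite -/w => hg.
have gE : g y (X y) (X y) <= `|'D_w F q|.
  by rewrite -hd dfun_field normrN ler_norm.
have [w0|w0] := eqVneq `|w| 0.
  by rewrite w0 !mulr_ge0 // ?invr_ge0 ltW.
have wp : 0 < `|w| by rewrite lt_neqAle eq_sym w0 normr_ge0.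
rewrite -mulrA ler_pdivlMl // -(ler_pM2r wp) -mulrA -expr2.
by apply: le_trans Dw; apply: le_trans gE.
Qed.

End LocalEstimates.

Lemma is_derive_coord (R : realType) n (gam : R^o -> 'rV[R]_n) (t : R^o) w j :
  is_derive t 1 gam w ->
  is_derive t 1 (fun s : R^o => gam s ord0 j : R^o) (w ord0 j).
Proof.
move=> [dg <-]; apply: DeriveDef; first exact: (derivable_mxP _ _ _).1.
by rewrite derive_mx // mxE.
Qed.

Lemma half_id_le (R : realType) (K x : R) : 0 < K -> (2 * K)^-1 * (K * x) <= 2^-1 * x.
Proof. by move=> K0; rewrite invfM -mulrA (mulrA K^-1) mulVf ?gt_eqF // mul1r. Qed.

(** * Critical points are fixed and other orbits descend *)

Section FlowOrbits.
Context {R : realType} {M : topologicalType} {n : nat}.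
Variables (A : smooth_structure R M n) (f : M -> R).
Variables (g : M -> 'rV[R]_n -> 'rV[R]_n -> R) (X : M -> 'rV[R]_n).
Variable phi : R -> M -> M.
Hypotheses (f_smooth : smooth_fun A f) (g_metric : riemannian_metric A g).
Hypothesis X_grad : is_gradient A g f (fun x => - X x).
Hypothesis phi_flow : is_flow A X phi.

(** A uniqueness argument in the manner of Gronwall: the largest distance from [q0] on a short time
    interval is at most half of itself. *)
Lemma crit_fixed_near p : crit A f p ->
  exists2 e : R, 0 < e & forall t, `|t| <= e -> phi t p = p.
Proof.
move=> critp; set c := chart_at A p; set q0 := cmap c p.
have [K K0 HK] := field_linear_bound f_smooth g_metric X_grad critp.
have cp : cdom c p := mem_chart_at A p.
have near0 : \forall t \near (0 : R^o), cdom c (phi t p) /\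
    `|tcoord A c (phi t p) (X (phi t p))| <= K * `|cmap c (phi t p) - q0|.
  have H : nbhs (phi 0 p) (fun y => cdom c y /\
      `|tcoord A c y (X y)| <= K * `|cmap c y - q0|).
    by rewrite (flow0 phi_flow); apply: filterI => //; exact: near_cdom.
  exact: (flow_continuous_time phi_flow H).
have /nbhs_normP[e1 /= e10 He1] := near0.
(* [e1 / 2] keeps the closed time interval where the estimate holds; [(2 * K)^-1] produces the
   contraction factor 1/2. *)
pose e := Num.min (e1 / 2) (2 * K)^-1.
have ep : 0 < e by rewrite lt_min divr_gt0 //= invr_gt0 mulr_gt0.
have bnd t : `|t| <= e -> cdom c (phi t p) /\
    `|tcoord A c (phi t p) (X (phi t p))| <= K * `|cmap c (phi t p) - q0|.
  move=> te; apply: He1; rewrite /ball_ /= sub0r normrN.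
  apply: (le_lt_trans te); rewrite gt_min; apply/orP; left; lra.
pose q (t : R^o) := cmap c (phi t p).
have dq (t : R^o) : `|t| <= e ->
    is_derive t 1 q (tcoord A c (phi t p) (X (phi t p))).
  move=> te; apply: is_derive_flow_chart => //; first exact: chart_at_compatible.
  by have [] := bnd _ te.
have cq : {within `[- e, e], continuous (fun t : R => `|q t - q0|)}.
  apply: continuous_in_subspaceT => t /set_mem /=; rewrite in_itv /= => te.
  have {}te : `|t| <= e by rewrite ler_norml.
  have ct : {for (t : R^o), continuous q}.
    by apply: differentiable_continuous; apply/derivable1_diffP; have [] := dq _ te.
  have c1 : (q s - q0) @[s --> t] --> q t - q0.
    by apply: cvgB; [exact: ct|exact: cvg_cst].
  exact: (cvg_norm c1).
have [|m mI mP] := EVT_max _ cq; first by rewrite -subr_ge0 opprK addr_ge0 // ltW.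
have me : `|m| <= e by move: mI; rewrite in_itv /= ler_norml.
(* [m] is the time of largest distance. The mean value theorem bounds each coordinate of the
   displacement by |m| K times that same distance. *)
have qm0 : `|q m - q0| = 0.
  apply/eqP; rewrite eq_le normr_ge0 andbT.
  suff : `|q m - q0| <= 2^-1 * `|q m - q0| by lra.
  apply: norm_row_le => [|j]; first by rewrite mulr_ge0.
  pose G (t : R^o) : R^o := q t ord0 j.
  have sm s : 0 <= s <= 1 -> `|0 + s *: m| <= e.
    move=> /andP[s0 s1]; rewrite add0r normrZ ger0_norm //.
    by apply: le_trans me; rewrite ler_piMl.
  have dG (t : R^o) : `|t| <= e ->
      is_derive t 1 G (tcoord A c (phi t p) (X (phi t p)) ord0 j).
    by move=> te; exact/is_derive_coord/dq.
  have dG' (t : R^o) : `|t| <= e -> differentiable G t.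
    by move=> te; apply/derivable1_diffP; have [] := dG _ te.
  have [|s s01] := @mean_value_seg R _ G (0 : R^o) (m : R^o).
    by move=> s s01; apply: dG'; exact: sm.
  have ts := sm s s01.
  have -> : 'D_m G (0 + s *: m) = m * 'D_1 G (0 + s *: m).
    have mE : (m : R^o) = m *: (1 : R^o) by rewrite -[RHS]/(m * 1) mulr1.
    by have := @deriveZr R R^o R^o G _ m 1 (dG' _ ts); rewrite -mE.
  have [_ ->] := dG _ ts.
  rewrite !add0r /G /q (flow0 phi_flow) => GE.
  have -> : (cmap c (phi m p) - q0) ord0 j =
      m * tcoord A c (phi (s *: m) p) (X (phi (s *: m) p)) ord0 j.
    by rewrite -GE !mxE.
  have [_ hK] := bnd _ ts.
  rewrite normrM.
  have hm : `|q (s *: m) - q0| <= `|q m - q0|.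
    apply: mP; rewrite in_itv /= -ler_norml.
    by move: ts; rewrite add0r.
  have : `|tcoord A c (phi (s *: m) p) (X (phi (s *: m) p)) ord0 j| <=
      K * `|q m - q0|.
    apply: (le_trans (coord_le_norm _ _)).
    rewrite add0r in hK; apply: (le_trans hK).
    by rewrite ler_pM2l.
  move=> h; apply: (@le_trans _ _ ((2 * K)^-1 * (K * `|q m - q0|))).
    apply: (ler_pM (normr_ge0 _) (normr_ge0 _) _ h).
    by apply: (le_trans me); rewrite ge_min lexx orbT.
  exact: (half_id_le _ K0).
exists e => // t te.
have /bnd[ct _] := te.
have : `|q t - q0| <= 0 by rewrite -qm0; apply: mP; rewrite in_itv /= -ler_norml.
rewrite normr_le0 subr_eq0 => /eqP qt.
by rewrite -(cmapK ct) -/(q t) qt cmapK.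
Qed.

Lemma crit_fixed p t : crit A f p -> phi t p = p.
Proof.
move=> /crit_fixed_near[e e0 He].
have iter N s : phi s p = p -> phi (N%:R * s) p = p.
  move=> ps; elim: N => [|N IH]; first by rewrite mul0r (flow0 phi_flow).
  by rewrite -natr1 mulrDl mul1r (flowD phi_flow) ps.
pose N := (Num.truncn (`|t| / e)).+1.
have N0 : 0 < N%:R :> R by rewrite ltr0n.
have -> : t = N%:R * (t / N%:R) by rewrite mulrC divfK // gt_eqF.
apply: iter; apply: He.
rewrite normrM normfV (gtr0_norm N0) ler_pdivrMr // mulrC -ler_pdivrMr //.
exact: ltW (truncnS_gt _).
Qed.

Lemma flowK t x : phi (- t) (phi t x) = x.
Proof. by rewrite -(flowD phi_flow) addNr (flow0 phi_flow). Qed.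

Lemma noncrit_flow x t : ~ crit A f x -> ~ crit A f (phi t x).
Proof.
by move=> ncx cx; apply: ncx; rewrite -(flowK t x) (crit_fixed (- t) cx).
Qed.

Lemma is_derive_energy x (t : R^o) : is_derive t 1 (fun s : R^o => f (phi s x) : R^o)
  (- g (phi t x) (X (phi t x)) (X (phi t x))).
Proof.
rewrite -(dfun_field g_metric X_grad); exact: is_derive_flow_fun.
Qed.

Lemma energy_continuous x : continuous (fun t : R => f (phi t x)).
Proof.
move=> t; apply: (@differentiable_continuous _ _ _ (t : R^o)
  (fun s : R^o => f (phi s x) : R^o)).
by apply/derivable1_diffP; have [] := is_derive_energy x t.
Qed.

Lemma energy_decr x s t : ~ crit A f x -> s < t -> f (phi t x) < f (phi s x).
Proof.
move=> ncx st.
apply: (@ltr0_derive1_lt_cc _ (fun t : R => f (phi t x)) s t).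
- by move=> u _; have [] := is_derive_energy x u.
- move=> u _; rewrite derive1E; have [_ ->] := is_derive_energy x u.
  rewrite oppr_lt0; apply: (metric_field_pos g_metric).
  by apply/eqP => /(crit_field g_metric X_grad) cx; exact: (noncrit_flow ncx cx).
- by apply: continuous_subspaceT; exact: (@energy_continuous x).
- by rewrite in_itv /= lexx ltW.
- by rewrite in_itv /= lexx ltW.
- by [].
Qed.

End FlowOrbits.

(** * Length bounds from the Lojasiewicz inequality *)

Section SpeedBound.
Context {R : realType}.

(** Both [y + w] and [- y + w] are nonincreasing. *)
Lemma speed_bound (y y' w w' : R -> R) (a b : R) : a <= b ->
  {within `[a, b], continuous y} -> {within `[a, b], continuous w} ->
  (forall t : R^o, t \in `]a, b[%R -> is_derive t 1 (y : R^o -> R^o) (y' t)) ->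
  (forall t : R^o, t \in `]a, b[%R -> is_derive t 1 (w : R^o -> R^o) (w' t)) ->
  (forall t, t \in `]a, b[%R -> `|y' t| <= - w' t) ->
  `|y b - y a| <= w a - w b.
Proof.
move=> ab cy cw dy dw yw.
have H (s : R) : s = 1 \/ s = -1 -> s * y b + w b <= s * y a + w a.
  move=> s1.
  pose h : R -> R := (s *: (y : R^o -> R^o)) + w.
  have dh (t : R^o) : t \in `]a, b[%R -> is_derive t 1 (h : R^o -> R^o) (s *: y' t + w' t).
    by move=> tab; apply: is_deriveD; [apply: is_deriveZ; exact: dy|exact: dw].
  apply: (@ler0_derive1_le_cc R h a b _ _ _ b a _ _ ab).
  - by move=> t /dh[].
  - move=> t tab; rewrite derive1E; have [_ ->] := dh t tab.
    have := yw t tab; rewrite ler_norml => /andP[h1 h2].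
    by case: s1 => ->; rewrite ?scale1r ?scaleN1r; lra.
  - by move=> t; apply: cvgD; [apply: cvgZr; exact: cy|exact: cw].
  - by rewrite in_itv /= lexx andbT.
  - by rewrite in_itv /= lexx.
have h1 := H 1 (or_introl erefl); have h2 := H (-1) (or_intror erefl).
by rewrite ler_norml; apply/andP; split; lra.
Qed.

(** The hypothesis says that |y'| is at most the rate of decrease of 2 C sqrt u, whose derivative is
    C u' / sqrt u. *)
Lemma speed_bound_sqrt (y y' u u' : R -> R) (a b C : R) : a <= b -> 0 <= C ->
  {within `[a, b], continuous y} -> {within `[a, b], continuous u} ->
  (forall t : R^o, t \in `]a, b[%R -> is_derive t 1 (y : R^o -> R^o) (y' t)) ->
  (forall t : R^o, t \in `]a, b[%R -> is_derive t 1 (u : R^o -> R^o) (u' t)) ->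
  (forall t, t \in `]a, b[%R -> 0 < u t) ->
  (forall t, t \in `]a, b[%R -> Num.sqrt (u t) * `|y' t| <= C * - u' t) ->
  `|y b - y a| <= 2 * C * Num.sqrt (u a) - 2 * C * Num.sqrt (u b).
Proof.
move=> ab C0 cy cu dy du u0 H.
apply: (@speed_bound y y' (fun t => 2 * C * Num.sqrt (u t))
  (fun t => 2 * C * ((2 * Num.sqrt (u t))^-1 * u' t)) a b ab cy _ dy).
- move=> t; apply: cvgM; first exact: cvg_cst.
  apply: continuous_comp; [exact: cu|exact: sqrt_continuous].
- move=> t tab.
  apply: (@is_deriveZ _ _ _ (fun t => Num.sqrt (u t))).
  have dsq := is_derive1_sqrt (u0 t tab).
  exact: (is_derive1_comp dsq (du t tab)).
move=> t tab; have sq0 : 0 < Num.sqrt (u t) by rewrite sqrtr_gt0 u0.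
rewrite -(ler_pM2l sq0); apply: (le_trans (H t tab)).
rewrite le_eqVlt; apply/orP; left; apply/eqP.
by field; rewrite gt_eqF.
Qed.

Lemma speed_bound_sqrtN (y y' u u' : R -> R) (a b C : R) : a <= b -> 0 <= C ->
  {within `[a, b], continuous y} -> {within `[a, b], continuous u} ->
  (forall t : R^o, t \in `]a, b[%R -> is_derive t 1 (y : R^o -> R^o) (y' t)) ->
  (forall t : R^o, t \in `]a, b[%R -> is_derive t 1 (u : R^o -> R^o) (u' t)) ->
  (forall t, t \in `]a, b[%R -> u t < 0) ->
  (forall t, t \in `]a, b[%R -> Num.sqrt (- u t) * `|y' t| <= C * - u' t) ->
  `|y b - y a| <= 2 * C * Num.sqrt (- u b) - 2 * C * Num.sqrt (- u a).
Proof.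
move=> ab C0 cy cu dy du u0 H.
have cv : {within `[a, b], continuous (fun t => - u t)}.
  by move=> t; apply: cvgN; exact: cu.
rewrite [leRHS]addrC -[2 * C * Num.sqrt (- u b)]opprK.
apply: (@speed_bound y y' (fun t => - (2 * C * Num.sqrt (- u t)))
  (fun t => - (2 * C * ((2 * Num.sqrt (- u t))^-1 * - u' t))) a b ab cy _ dy).
- move=> t; apply: cvgN; apply: cvgM; first exact: cvg_cst.
  exact: (continuous_comp (cv t) (@sqrt_continuous R _)).
- move=> t tab; apply: is_deriveN.
  apply: (@is_deriveZ _ _ _ (fun t => Num.sqrt (- u t))).
  have u0' : 0 < - u t by rewrite oppr_gt0 u0.
  have dsq := is_derive1_sqrt u0'.
  exact: (@is_derive1_comp R Num.sqrt (fun t => - u t) t _ _ dsq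
    (is_deriveN (du t tab))).
move=> t tab; have sq0 : 0 < Num.sqrt (- u t) by rewrite sqrtr_gt0 oppr_gt0 u0.
rewrite -(ler_pM2l sq0); apply: (le_trans (H t tab)).
rewrite le_eqVlt; apply/orP; left; apply/eqP.
by field; rewrite gt_eqF.
Qed.

Lemma le_sub_bound (x p q r : R) : x <= p - q -> 0 <= q -> p <= r -> x <= r.
Proof. by lra. Qed.

(** The square root is not differentiable where [u] vanishes. As [u] is strictly decreasing this
    happens at most once; the interval is cut there and each half contributes at most 2 C sqrt d. *)
Lemma speed_bound_level (y y' u u' : R -> R) (a b C d : R) : a <= b -> 0 <= C ->
  {within `[a, b], continuous y} -> {within `[a, b], continuous u} ->
  (forall t : R^o, t \in `]a, b[%R -> is_derive t 1 (y : R^o -> R^o) (y' t)) ->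
  (forall t : R^o, t \in `]a, b[%R -> is_derive t 1 (u : R^o -> R^o) (u' t)) ->
  (forall s t, s < t -> u t < u s) ->
  (forall t, t \in `]a, b[%R -> Num.sqrt `|u t| * `|y' t| <= C * - u' t) ->
  `|u a| <= d -> `|u b| <= d ->
  `|y b - y a| <= 4 * C * Num.sqrt d.
Proof.
move=> ab C0 cy cu dy du udec H ua ub.
have sq x : `|x| <= d -> 0 <= x -> Num.sqrt x <= Num.sqrt d.
  by rewrite ger0_def => + /eqP xE; rewrite xE => xd; exact: ler_wsqrtr.
have C2 x : x <= Num.sqrt d -> 2 * C * x <= 2 * C * Num.sqrt d.
  by move=> xd; apply: ler_wpM2l => //; rewrite mulr_ge0.
have Cs x : 0 <= 2 * C * Num.sqrt x by rewrite !mulr_ge0 // sqrtr_ge0.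
have sub (c e : R) (v : R -> R) : a <= c -> e <= b ->
    {within `[a, b], continuous v} -> {within `[c, e], continuous v}.
  by move=> ac eb; apply: continuous_subspaceW; apply: subset_itv; rewrite bnd_simp.
have sub' (c e t : R) : a <= c -> e <= b -> t \in `]c, e[%R -> t \in `]a, b[%R.
  move=> ac eb; rewrite !in_itv /= => /andP[h1 h2].
  by rewrite (le_lt_trans ac h1) (lt_le_trans h2 eb).
have Pos c : a <= c <= b -> 0 <= u c ->
    `|y c - y a| <= 2 * C * Num.sqrt d.
  move=> /andP[ac cb] uc.
  have ut t : t \in `]a, c[%R -> 0 < u t.
    by rewrite in_itv /= => /andP[_ tc]; exact: le_lt_trans uc (udec _ _ tc).
  have ua0 : 0 <= u a.
    move: ac; rewrite le_eqVlt => /predU1P[->//|ac].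
    exact: ltW (le_lt_trans uc (udec _ _ ac)).
  have ac' t : t \in `]a, c[%R -> t \in `]a, b[%R := @sub' a c t (lexx a) cb.
  have H' t : t \in `]a, c[%R -> Num.sqrt (u t) * `|y' t| <= C * - u' t.
    by move=> tc; rewrite -(gtr0_norm (ut t tc)); exact: H (ac' t tc).
  have P1 := @speed_bound_sqrt y y' u u' a c C ac C0 (sub _ _ _ (lexx a) cb cy)
    (sub _ _ _ (lexx a) cb cu) (fun t tc => dy t (ac' t tc))
    (fun t tc => du t (ac' t tc)) ut H'.
  exact: (le_sub_bound P1 (Cs _) (C2 _ (sq _ ua ua0))).
have Neg c : a <= c <= b -> u c <= 0 ->
    `|y b - y c| <= 2 * C * Num.sqrt d.
  move=> /andP[ac cb] uc.
  have ut t : t \in `]c, b[%R -> u t < 0.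
    by rewrite in_itv /= => /andP[ct _]; exact: lt_le_trans (udec _ _ ct) uc.
  have ub0 : 0 <= - u b.
    rewrite oppr_ge0; move: cb; rewrite le_eqVlt => /predU1P[<-//|cb].
    exact: ltW (lt_le_trans (udec _ _ cb) uc).
  have cb' t : t \in `]c, b[%R -> t \in `]a, b[%R := @sub' c b t ac (lexx b).
  have H' t : t \in `]c, b[%R -> Num.sqrt (- u t) * `|y' t| <= C * - u' t.
    by move=> tc; rewrite -(ltr0_norm (ut t tc)); exact: H (cb' t tc).
  have P1 := @speed_bound_sqrtN y y' u u' c b C cb C0 (sub _ _ _ ac (lexx b) cy)
    (sub _ _ _ ac (lexx b) cu) (fun t tc => dy t (cb' t tc))
    (fun t tc => du t (cb' t tc)) ut H'.
  rewrite -normrN in ub.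
  exact: (le_sub_bound P1 (Cs _) (C2 _ (sq _ ub ub0))).
have Csd : 0 <= 2 * C * Num.sqrt d by exact: Cs.
have E4 : 4 * C * Num.sqrt d = 2 * C * Num.sqrt d + 2 * C * Num.sqrt d by ring.
have [ub0|ub0] := leP 0 (u b).
  by rewrite E4 (le_trans (Pos b _ ub0)) ?ab ?lexx // lerDl.
have [ua0|ua0] := leP (u a) 0.
  by rewrite E4 (le_trans (Neg a _ ua0)) ?ab ?lexx // lerDl.
(* The remaining case: [u] changes sign, and [c] is its zero. *)
have [|c cab uc0] := @IVT R u a b 0 ab cu.
  by rewrite (min_r (ltW (lt_trans ub0 ua0))) (max_l (ltW (lt_trans ub0 ua0))) !ltW.
move: cab; rewrite in_itv /= => cab.
have -> : y b - y a = (y b - y c) + (y c - y a) by rewrite addrA subrK.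
by rewrite (le_trans (ler_normD _ _)) // E4 lerD // ?Neg ?Pos // uc0.
Qed.

End SpeedBound.

(** * Critical manifolds *)

Section CriticalLocal.
Context {R : realType} {M : topologicalType} {n : nat}.
Variables (A : smooth_structure R M n) (f : M -> R).
Variables (g : M -> 'rV[R]_n -> 'rV[R]_n -> R) (X : M -> 'rV[R]_n).
Hypotheses (f_smooth : smooth_fun A f) (g_metric : riemannian_metric A g).
Hypothesis X_grad : is_gradient A g f (fun x => - X x).
Hypothesis f_MB : morse_bott A f.

Local Notation Sig := (crit A f).

Section at_point.
Variable p : M.
Hypothesis critp : Sig p.
Local Notation d := (chart_at A p).
Local Notation F := (f \o cinv d : 'rV[R]_n -> R^o).

Section slice.
Variables (c : chart R M n) (k : nat).
Hypotheses (cp : cdom c p) (cc : compatible_chart A c).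
Hypothesis slice : forall y, cdom c y ->
  (Sig y <-> forall j : 'I_n, (k <= j)%N -> cmap c y ord0 j = 0).

Let P : pred 'I_n := fun j => (k <= j)%N.
Let L := cmap d \o cinv c.
Let r0 := cmap c p.
Let dp : cdom d p := mem_chart_at A p.

Let sliceP y : cdom c y -> Sig y <-> coord_plane P (cmap c y).
Proof. exact: slice. Qed.

Let sL : smooth_at L r0.
Proof. by apply: transition_smooth_at => //; exact: (proj1 (cc p)). Qed.

Let Lr0 : L r0 = cmap d p. Proof. exact: transitionE. Qed.

(** The image of [z] lies in the radical of the Hessian, hence is the velocity of a curve in Sigma.
    Read in the slice chart, that curve has vanishing coordinates in [P], so [z] has no component in
    [P]; the other components vanish by hypothesis. *)
Lemma slice_nondegenerate z : coord_plane (predC P) z ->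
  (forall v, 'D_('D_z L r0) ('D_v F) (L r0) = 0) -> z = 0.
Proof.
move=> zP H; set u := 'D_z L r0 in H.
have [gam [[gd sgam] gam0 vgam gSig]] : tangent A Sig p u.
  by apply: (proj2 f_MB p critp) => v; have := H v; rewrite Lr0; exact.
rewrite gam0 in gd sgam; rewrite /velocity gam0 in vgam.
have dgam : is_derive (0 : R^o) 1 (cmap d \o gam) u.
  apply: DeriveDef => //; apply/derivable1_diffP.
  exact/C1_at_differentiable/smooth_at_C1.
have E0 : (cmap d \o gam) 0 = cmap d p by rewrite /= gam0.
have [s1 s2] := cc p.
have dL' : differentiable (cmap c \o cinv d) ((cmap d \o gam) 0).
  rewrite E0; exact/C1_at_differentiable/smooth_at_C1/transition_smooth_at.
have := is_derive_curve dgam dL'.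
have -> : 'D_u (cmap c \o cinv d) ((cmap d \o gam) 0) = z.
  by rewrite E0; exact: (derive_transitionK z s1 s2 cp dp).
move=> dz; apply/rowP => j; rewrite mxE.
have [Pj|/negbTE Pj] := boolP (P j); last by rewrite zP //= Pj.
have := is_derive_coord j dz; move=> [_ <-].
have nc : \forall t \near (0 : R^o), cdom c (gam t).
  have cg : {for (0 : R^o), continuous (cmap d \o gam)}.
    exact/C1_at_continuous/smooth_at_C1.
  have nq : \forall q \near (cmap d \o gam) 0, cdom c (cinv d q).
    rewrite E0; have := near_cinv dp (open_nbhs_nbhs (conj (cdom_open c) cp)).
    by apply: filterS => q [].
  apply: filterS2 gd (cg _ nq) => t dt /=.
  by rewrite (cmapK dt).
rewrite -[RHS](@derive_cst R R^o R^o 0 0 1); apply: near_eq_derive.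
apply: filterS3 gd gSig nc => t dt St ct.
by rewrite /= (cmapK dt); apply: (sliceP ct).1.
Qed.

Lemma slice_crit : \forall r \near r0, coord_plane P r ->
  forall v, 'D_v F (L r) = 0.
Proof.
have nd := near_dfun_chart f_smooth p.
have H := near_cinv cp (@filterI _ (nbhs p) (nbhs_filter p) _ _ (near_cdom A p) nd).
apply: filterS H => r [cr [dr hr] rK] Pr v.
have Sy : Sig (cinv c r) by apply/sliceP; rewrite ?rK.
have := Sy (tvec A d (cinv c r) v).
by rewrite hr tvecK //; exact: chart_at_compatible.
Qed.

Lemma slice_lojasiewicz : exists2 K : R, 0 < K &
  \forall y \near p, `|f y - f p| <= K * `|tcoord A d y (X y)| ^+ 2.
Proof.
have CL : C1_at L r0 by exact: smooth_at_C1.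
have sF : smooth_at F (L r0) by rewrite Lr0; exact: f_smooth.
have r0P : coord_plane P r0 by apply/sliceP.
have [K K0 HK] := lojasiewicz CL sF r0P slice_crit slice_nondegenerate.
have [C C0 HC] := differential_upper f_smooth g_metric X_grad p.
(* The differential is evaluated at a vector of norm at most [K], so it is at most [C * K] times the
   coordinate length of [X]. *)
exists (K * (C * K) ^+ 2).
  by rewrite mulr_gt0 // exprn_gt0 // mulr_gt0.
have nK := near_cmap cp HK.
apply: filterS3 nK HC (near_cdom A p) => y [cy [v vK]] + hC dy.
rewrite Lr0 /L /= (cmapK cy) (cmapK dy) (cmapK dp) => h.
apply: (le_trans h); rewrite -mulrA; apply: (ler_wpM2l (ltW K0)).
have CK : 0 <= C * K by exact/ltW/mulr_gt0.
rewrite -exprMn lerXn2r ?nnegrE ?(mulr_ge0 CK) //.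
apply: (le_trans (hC v)); rewrite -!mulrA; apply: (ler_wpM2l (ltW C0)).
by rewrite mulrC; exact: (ler_wpM2r (normr_ge0 _)).
Qed.

(** In the slice chart the straight segment from [p] to [y] stays in the plane, hence in Sigma. *)
Lemma slice_component : \forall y \near p, Sig y -> connected_component Sig p y.
Proof.
have H := near_cinv cp (@filterT _ (nbhs p) (nbhs_filter p)).
have [e e0 He] := (ball_row_near _ _).1 H.
have nb : \forall r \near r0, `|r - r0| < e by apply/ball_row_near; exists e.
apply: filterS (near_cmap cp nb) => y [cy ye] Sy.
pose gam (t : R) := r0 + t *: (cmap c y - r0).
have r0P : coord_plane P r0 by apply/sliceP.
have yP : coord_plane P (cmap c y) by apply/sliceP.
have r00 : `|r0 - r0| < e by rewrite subrr normr0.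
have gb t : 0 <= t <= 1 -> [/\ cdom c (cinv c (gam t)), True &
    cmap c (cinv c (gam t)) = gam t].
  by move=> t01; apply: He; exact: segment_ball.
pose D := (cinv c \o gam) @` `[0, 1]%classic.
have cD : connected D.
  apply: connected_continuous_connected; first exact: segment_connected.
  apply: continuous_in_subspaceT => t /set_mem /=; rewrite in_itv /= => t01.
  have [h1 _ h2] := gb t t01.
  have cg : {for t, continuous gam}.
    apply: cvgD; first exact: cvg_cst.
    by apply: cvgZl; exact: cvg_id.
  have := cinv_continuous h1; rewrite h2 => ci.
  exact: (continuous_comp cg ci).
apply: (connected_component_max (B := D)) => //.
- exists 0; first by rewrite /= ?in_itv /= lexx ler01.
  by rewrite /= /gam scale0r addr0 cmapK.
- move=> _ [t + <-] /=; rewrite ?in_itv /= => t01; have [h1 _ h2] := gb t t01.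
  by apply/sliceP => //; rewrite h2; exact: coord_plane_convex.
- exists 1; first by rewrite /= ?in_itv /= lexx ler01.
  by rewrite /= /gam scale1r addrC subrK cmapK.
Qed.

End slice.

Lemma crit_lojasiewicz : exists2 K : R, 0 < K &
  \forall y \near p, `|f y - f p| <= K * `|tcoord A d y (X y)| ^+ 2.
Proof.
have [c [k [cp cc sl]]] := (proj1 f_MB).2 p critp.
exact: slice_lojasiewicz cp cc sl.
Qed.

(** Where [X] vanishes, the Lojasiewicz inequality itself reads [f y = f p]. *)
Lemma crit_component_near : \forall y \near p, Sig y ->
  connected_component Sig p y /\ f y = f p.
Proof.
have [c [k [cp cc sl]]] := (proj1 f_MB).2 p critp.
have [K K0 HK] := crit_lojasiewicz.
apply: filterS2 HK (slice_component cp sl) => y hK hc Sy; split; first exact: hc.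
have X0 := (crit_field g_metric X_grad y).1 Sy.
move: hK; rewrite X0 /tcoord derive0 normr0 expr0n mulr0 normr_le0 subr_eq0.
by move/eqP.
Qed.

(* Dividing the Lojasiewicz inequality |f - f(p)| <= K |X|^2 by |X|: along the
   flow, sqrt |f - f(p)| decreases at least proportionally to the speed. *)
Lemma crit_speed : exists2 C : R, 0 < C & \forall y \near p,
  Num.sqrt `|f y - f p| * `|tcoord A d y (X y)| <= C * g y (X y) (X y).
Proof.
have [K K0 HK] := crit_lojasiewicz.
have [C C0 HC] := metric_lower g_metric p.
exists (Num.sqrt K / C); first by rewrite divr_gt0 // sqrtr_gt0.
apply: filterS2 HK HC => y hK /(_ (X y)) hC.
set w := `|tcoord A d y (X y)| in hK hC *.
have w0 : 0 <= w by exact: normr_ge0.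
have sK : Num.sqrt `|f y - f p| <= Num.sqrt K * w.
  have <- : Num.sqrt (K * w ^+ 2) = Num.sqrt K * w.
    by rewrite (sqrtrM _ (ltW K0)) sqrtr_sqr (ger0_norm w0).
  exact: (ler_wsqrtr hK).
apply: (le_trans (ler_wpM2r w0 sK)); rewrite -mulrA -expr2.
rewrite -mulrA; apply: (ler_wpM2l (sqrtr_ge0 _)).
by rewrite -ler_pdivrMl ?invr_gt0 // invrK.
Qed.

End at_point.

Lemma crit_closed : closed Sig. Proof. by have [[]] := f_MB. Qed.

(** The level set of [f p] is closed in the component by continuity and open in it because f is
    locally constant on Sigma. *)
Lemma component_level p q : Sig p -> connected_component Sig p q -> f q = f p.
Proof.
move=> Sp pq.
have cD : connected (connected_component Sig p) by exact: component_connected.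
pose B := [set y | connected_component Sig p y /\ f y = f p].
suff : B = connected_component Sig p by rewrite predeqE => /(_ q)[_ /(_ pq)[]].
have cf := smooth_fun_continuous f_smooth.
apply: cD.
- by exists p; split => //; exact: connected_component_refl.
(* An open set of M is required that cuts out the level set in the component; off Sigma the
   condition is left void. *)
- exists (interior [set y | ~ Sig y \/ f y = f p]).
    exact: open_interior.
  rewrite predeqE => y; split.
    move=> [py fy]; split => //.
    have Sy : Sig y by exact: connected_component_sub py.
    apply: filterS (crit_component_near Sy) => z hz.
    by have [Sz|nSz] := pselect (Sig z); [right; rewrite (proj2 (hz Sz))|left].
  move=> [py /nbhs_singleton [nSy|fy]]; last by split.
  by exfalso; apply: nSy; exact: connected_component_sub py.
- exists (f @^-1` [set f p]); last by rewrite predeqE => y; split => [[]|[]].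
  by apply: closed_comp => [y _|]; [exact: cf|exact: closed_eq].
Qed.

End CriticalLocal.

(** * Equicontinuity of orbits *)

Lemma is_derive_rev (R : realType) (V : normedModType R) (F : R^o -> V) (t : R^o) w :
  is_derive (- t) 1 F w -> is_derive t 1 (fun s : R^o => F (- s)) (- w).
Proof.
move=> [dF <-].
have dF' : differentiable F (- t) by apply/derivable1_diffP.
have := is_derive_curve (is_deriveNid t 1) dF'.
by rewrite [X in is_derive _ _ _ X]deriveE // linearN -deriveE.
Qed.

Section Exit.
Context {R : realType} {M : topologicalType} {n : nat}.
Variables (d : chart R M n) (p : M) (e : R).
Hypotheses (M_hausdorff : hausdorff_space M) (dp : cdom d p).
Hypothesis dball : forall q, `|q - cmap d p| < e ->
  cdom d (cinv d q) /\ cmap d (cinv d q) = q.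

Definition chart_ball : set M := [set y | cdom d y /\ `|cmap d y - cmap d p| < e].

Variables (gam : R -> M) (u u' : R -> R) (w : R -> 'rV[R]_n) (C dl : R).
Hypotheses (C0 : 0 <= C) (small : 4 * C * Num.sqrt dl <= e / 3).
Hypotheses (cgam : continuous gam) (udec : forall s t, s < t -> u t < u s).
Hypothesis du : forall t : R^o, is_derive t 1 (u : R^o -> R^o) (u' t).
Hypothesis dgam : forall t : R^o, chart_ball (gam t) ->
  is_derive t 1 (cmap d \o gam : R^o -> _) (w t).
Hypothesis speed : forall t, chart_ball (gam t) ->
  Num.sqrt `|u t| * `|w t| <= C * - u' t.
Variable T : R.
Hypotheses (T0 : 0 <= T) (u0 : `|u 0| <= dl) (uT : `|u T| <= dl).
Hypotheses (gam0 : cdom d (gam 0)) (gam0' : `|cmap d (gam 0) - cmap d p| < e / 3).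

(** [gam] stands for an orbit run forwards or backwards, and [u] for the difference of f and [f p]
    with the sign that makes it decrease. As long as the curve is in the ball, each coordinate moves
    by at most 4 C sqrt dl. *)
Lemma chart_ball_travel t : 0 <= t <= T ->
  (forall s, 0 <= s <= t -> chart_ball (gam s)) ->
  `|cmap d (gam t) - cmap d (gam 0)| <= e / 3.
Proof.
move=> /andP[t0 tT] gs.
have e30 : 0 <= e / 3 by exact: le_trans (normr_ge0 _) (ltW gam0').
apply: norm_row_le => // j; rewrite !mxE.
have dy (s : R^o) : chart_ball (gam s) ->
    is_derive s 1 (fun s : R^o => cmap d (gam s) ord0 j : R^o) (w s ord0 j).
  by move=> /dgam ds; exact: is_derive_coord ds.
have ule s t' : s <= t' -> u t' <= u s.
  by rewrite le_eqVlt => /predU1P[->//|st]; exact/ltW/udec.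
have ut : `|u t| <= dl.
  have h1 := ule _ _ t0; have h2 := ule _ _ tT.
  move: u0 uT; rewrite !ler_norml => /andP[a1 a2] /andP[a3 a4].
  by rewrite (le_trans a3 h2) (le_trans h1 a2).
apply: le_trans small.
apply: (@speed_bound_level R (fun s => cmap d (gam s) ord0 j) (fun s => w s ord0 j)
  u u' 0 t C dl t0 C0 _ _ _ _ udec _ u0 ut).
- apply: derivable_within_continuous => s; rewrite in_itv /= => st.
  by have [] := dy s (gs s st).
- by apply: derivable_within_continuous => s _; have [] := du s.
- move=> s; rewrite in_itv /= => /andP[s0 st]; apply: dy; apply: gs.
  by rewrite !ltW.
- move=> s; rewrite in_itv /= => /andP[s0 st].
  have sb : chart_ball (gam s) by apply: gs; rewrite !ltW.
  apply: (le_trans _ (speed sb)); apply: (ler_wpM2l (sqrtr_ge0 _)).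
  exact: coord_le_norm.
Qed.

(** Continuation: up to any time at which the curve has not yet left the ball, it is within e/3 +
    e/3 of the centre. At the supremum of such times it is therefore still inside, and, the ball
    being open, it stays there a little longer unless [T] has been reached. *)
Lemma chart_ball_stay : chart_ball (gam T).
Proof.
have e0 : 0 < e.
  by have := le_lt_trans (normr_ge0 _) gam0'; rewrite pmulr_lgt0 // invr_gt0.
(* [K] must be closed in M and not just in the chart domain, so that a limit of the curve cannot
   leave the domain; this is where M being Hausdorff enters, through compactness of [K]. *)
pose K : set M := cinv d @` [set q | `|q - cmap d p| <= 2 * (e / 3)].
have e23 : 2 * (e / 3) < e by lra.
have K_closed : closed K.
  apply: compact_closed => //; apply: continuous_compact; last first.
    apply: bounded_closed_compact.
      exists (`|cmap d p| + 2 * (e / 3)); split; first exact: num_real.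
      move=> x hx q /= hq; apply: ltW; apply: le_lt_trans hx.
      have := ler_normD (q - cmap d p) (cmap d p); rewrite subrK => h.
      by apply: (le_trans h); rewrite addrC lerD2l.
    apply: (closed_comp (f := fun q : 'rV[R]_n => `|q - cmap d p|)
      (D := [set x | x <= 2 * (e / 3)])) => [q _|]; last exact: closed_le.
    have c1 : (r - cmap d p) @[r --> q] --> q - cmap d p.
      exact: (cvgB (@cvg_id _ (nbhs q)) (cvg_cst (cmap d p))).
    exact: (cvg_norm c1).
  apply: continuous_in_subspaceT => q /set_mem /= hq.
  have [h1 h2] := dball (le_lt_trans hq e23).
  by have := cinv_continuous h1; rewrite h2.
have K_ball : K `<=` chart_ball.
  move=> _ [q /= hq <-]; have [h1 h2] := dball (le_lt_trans hq e23).
  by split; rewrite // h2; exact: le_lt_trans e23.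
pose G : set R := [set t | 0 <= t <= T /\ forall s, 0 <= s <= t -> chart_ball (gam s)].
have GK t : G t -> K (gam t).
  move=> [tT gs]; have tr := chart_ball_travel tT gs.
  have [ct _] : chart_ball (gam t).
    by apply: gs; rewrite lexx andbT; case/andP: tT.
  exists (cmap d (gam t)); last exact: cmapK.
  rewrite /= -(subrKA (cmap d (gam 0))) (le_trans (ler_normD _ _)) //.
  by have := ltW gam0'; lra.
have G0 : G 0.
  split; first by rewrite lexx.
  move=> s; rewrite -eq_le => /eqP <-; split => //.
  by apply: lt_trans gam0' _; lra.
have Gsup : has_sup G.
  by split; [exists 0|exists T => t [/andP[]]].
set tau := sup G.
have tau0 : 0 <= tau by apply: ub_le_sup => //; case: Gsup.
have tauT : tau <= T by apply: ge_sup => [|t [/andP[]]//]; exists 0.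
have Gtau s : 0 <= s < tau -> G s.
  move=> /andP[s0 st].
  have ts0 : 0 < tau - s by rewrite subr_gt0.
  have [t [tT gs]] := sup_adherent ts0 Gsup; rewrite -/tau subKr => st'.
  split; first by rewrite s0 (le_trans (ltW st')) //; case/andP: tT.
  move=> r /andP[r0 rs]; apply: gs; rewrite r0 (le_trans rs) //; exact: ltW.
have Ktau : K (gam tau).
  move: tau0; rewrite le_eqVlt => /predU1P[<-|tau0]; first exact: GK.
  have ctau : gam s @[s --> tau^'-] --> gam tau.
    exact: (cvg_at_left_filter (@cgam tau)).
  apply: (@closed_cvg _ _ (tau^'-) _ gam K K_closed _ _ ctau).
  near=> s; apply/GK/Gtau; apply/andP; split; near: s.
    exact: nbhs_left_ge.
  exact: nbhs_left_lt.
have [ct bt] := K_ball _ Ktau.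
have nt : \forall s \near tau, chart_ball (gam s).
  have nq : \forall q \near cmap d (gam tau), `|q - cmap d p| < e.
    have e'0 : 0 < e - `|cmap d (gam tau) - cmap d p| by rewrite subr_gt0.
    apply/ball_row_near; exists (e - `|cmap d (gam tau) - cmap d p|) => // q hq.
    rewrite -(subrKA (cmap d (gam tau))) (le_lt_trans (ler_normD _ _)) //.
    by rewrite -ltrBrDr.
  exact: (cgam (near_cmap ct nq)).
have /nbhs_normP[r /= r0 Hr] := nt.
have GT s : 0 <= s -> s < tau + r -> s <= T -> G s.
  move=> s0 sr sT; split; first by rewrite s0.
  move=> s' /andP[s'0 s's]; have [s't|ts'] := ltP s' tau.
    have [_ h] := Gtau s' (introT andP (conj s'0 s't)).
    by apply: h; rewrite s'0 lexx.
  apply: Hr; rewrite /ball_ /= distrC ger0_norm ?subr_ge0 // ltrBlDl.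
  exact: le_lt_trans sr.
suff [_] : G T by apply; rewrite T0 lexx.
have [Tr|Tt] := ltP T (tau + r); first exact: (GT T T0 Tr (lexx T)).
have ub s : G s -> s <= tau by apply: ub_le_sup; case: Gsup.
have : tau + r / 2 <= tau.
  by apply/ub/GT; lra.
by rewrite gerDl pmulr_lle0 // leNgt r0.
Unshelve. all: by end_near. Qed.

End Exit.

(** * Trapping orbits by the values of f *)

Section KeyLemma.
Context {R : realType} {M : topologicalType} {n : nat}.
Variables (A : smooth_structure R M n) (f : M -> R).
Variables (g : M -> 'rV[R]_n -> 'rV[R]_n -> R) (X : M -> 'rV[R]_n).
Variable phi : R -> M -> M.
Hypothesis M_hausdorff : hausdorff_space M.
Hypotheses (f_smooth : smooth_fun A f) (g_metric : riemannian_metric A g).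
Hypothesis X_grad : is_gradient A g f (fun x => - X x).
Hypothesis phi_flow : is_flow A X phi.
Hypothesis f_MB : morse_bott A f.

Let f_cont := smooth_fun_continuous f_smooth.

Lemma crit_orbit_trap p (U : set M) : crit A f p -> nbhs p U ->
  exists2 V : set M, nbhs p V & exists2 dl : R, 0 < dl &
    forall x T, V x -> `|f (phi T x) - f p| < dl -> U (phi T x).
Proof.
move=> critp Up; set d := chart_at A p.
have dp : cdom d p := mem_chart_at A p.
have [C C0 HC] := crit_speed f_smooth g_metric X_grad f_MB critp.
have [e e0 He] := (ball_row_near _ _).1
  (near_cinv dp (@filterI _ (nbhs p) (nbhs_filter p) _ _ Up HC)).
pose N := chart_ball d p e.
have NU y : N y -> U y /\ Num.sqrt `|f y - f p| * `|tcoord A d y (X y)| <=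
    C * g y (X y) (X y).
  by move=> [dy ye]; have [_ + _] := He _ ye; rewrite cmapK.
have dball q : `|q - cmap d p| < e -> cdom d (cinv d q) /\ cmap d (cinv d q) = q.
  by move=> /He[].
(* Chosen so that 4 C sqrt dl = e / 3. *)
pose dl := (e / (12 * C)) ^+ 2.
have dl0 : 0 < dl by rewrite exprn_gt0 // divr_gt0 // mulr_gt0.
have small : 4 * C * Num.sqrt dl <= e / 3.
  rewrite sqrtr_sqr ger0_norm; last by rewrite divr_ge0 ?mulr_ge0 ?ltW.
  by rewrite le_eqVlt; apply/orP; left; apply/eqP; field; rewrite gt_eqF.
have nf : \forall y \near p, `|f y - f p| < dl.
  have /cvgrPdist_lt /(_ _ dl0) := @f_cont p.
  by apply: filterS => y; rewrite distrC.
have nq : \forall q \near cmap d p, `|q - cmap d p| < e / 3.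
  by apply/ball_row_near; exists (e / 3) => //; rewrite divr_gt0.
exists ([set y | `|f y - f p| < dl] `&`
  [set y | cdom d y /\ `|cmap d y - cmap d p| < e / 3]).
  exact: (filterI nf (near_cmap dp nq)).
exists dl => // x T [fx [dx xe]] fT.
(* A critical [x] is fixed and treated apart, since the exit argument wants f strictly monotone
   along the orbit. *)
have [cx|ncx] := pselect (crit A f x).
  rewrite (crit_fixed f_smooth g_metric X_grad phi_flow _ cx).
  apply: (proj1 (NU x _)); split=> //; lra.
have phi0 : phi 0 x = x by exact: (flow0 phi_flow).
have chart_c := chart_at_compatible A p.
have dec := energy_decr f_smooth g_metric X_grad phi_flow.
have dE := is_derive_energy f_smooth g_metric X_grad phi_flow.
have [T0|T0] := leP 0 T.
  apply: (proj1 (NU _ _)).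
  apply: (@chart_ball_stay R M n d p e M_hausdorff dball (phi^~ x)
    (fun t => f (phi t x) - f p) (fun t => - g (phi t x) (X (phi t x)) (X (phi t x)))
    (fun t => tcoord A d (phi t x) (X (phi t x))) C dl (ltW C0) small _ _ _ _ _ T T0);
    rewrite ?phi0 //; try exact: ltW.
  - exact: (flow_continuous_time phi_flow).
  - by move=> s t st; rewrite ltrD2r; exact: (dec _ _ _ ncx st).
  - move=> t; rewrite -[X in is_derive _ _ _ X]subr0.
    exact: (is_deriveB (dE x t) (is_derive_cst (f p : R^o) t 1)).
  - by move=> t [dt _]; exact: (is_derive_flow_chart phi_flow chart_c dt).
  - by move=> t /NU[_]; rewrite opprK.
(* For [T] < 0 the orbit is run backwards; f increases along it, so f p - f replaces f - f p. *)
apply: (proj1 (NU _ _)); rewrite -[T]opprK.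
apply: (@chart_ball_stay R M n d p e M_hausdorff dball (fun t => phi (- t) x)
    (fun t => f p - f (phi (- t) x))
    (fun t => - g (phi (- t) x) (X (phi (- t) x)) (X (phi (- t) x)))
    (fun t => - tcoord A d (phi (- t) x) (X (phi (- t) x)))
    C dl (ltW C0) small _ _ _ _ _ (- T) _);
  rewrite ?opprK ?oppr0 ?phi0 // ?oppr_ge0; try by [exact: ltW|rewrite distrC ltW].
- move=> t; apply: (continuous_comp (f := fun t : R => - t) (g := phi^~ x)).
    exact: opp_continuous.
  exact: (flow_continuous_time phi_flow).
- move=> s t st; rewrite ltrD2l ltrN2.
  by apply: dec; rewrite ?ltrN2.
- move=> t; rewrite -[X in is_derive _ _ _ X]sub0r.
  have := @is_derive_rev R R^o (fun s => f (phi s x)) t _ (dE x (- t)).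
  rewrite opprK => dr.
  exact: (is_deriveB (is_derive_cst (f p : R^o) t 1) dr).
- move=> t [dt _]; apply: (@is_derive_rev R _ (fun s => cmap d (phi s x))).
  exact: (is_derive_flow_chart phi_flow chart_c dt).
- by move=> t /NU[_]; rewrite opprK normrN distrC.
Qed.

(** Within time [s] the orbit of [p] changes f by a definite amount in both directions, and so do
    nearby orbits. A small change of f thus forces |T| <= s, and continuity of the flow at (0, p)
    concludes. *)
Lemma regular_orbit_trap p (U : set M) : ~ crit A f p -> nbhs p U ->
  exists2 V : set M, nbhs p V & exists2 dl : R, 0 < dl &
    forall x T, V x -> `|f (phi T x) - f p| < dl -> U (phi T x).
Proof.
move=> ncp Up.
have dec := energy_decr f_smooth g_metric X_grad phi_flow.
have fdec x : ~ crit A f x -> forall s t, s <= t -> f (phi t x) <= f (phi s x).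
  by move=> ncx s t; rewrite le_eqVlt => /predU1P[->//|st]; exact/ltW/dec.
have H : nbhs (phi 0 p) U by rewrite (flow0 phi_flow).
have [[/= I V0] [/nbhs_normP[r /= r0 HI] Vp] HIV] :=
  flow_continuous phi_flow (t := 0) (x := p) H.
pose s := r / 2.
have s0 : 0 < s by rewrite divr_gt0.
pose a := f (phi (- s) p) - f p; pose b := f p - f (phi s p).
have p0 : phi 0 p = p := flow0 phi_flow p.
have a0 : 0 < a by rewrite subr_gt0 -{1}p0 dec // oppr_lt0.
have b0 : 0 < b by rewrite subr_gt0 -{2}p0 dec.
(* Halves, because [dl] is spent twice: on the value at time [T] and on comparing the orbits of [x]
   and [p] at time [s] or [- s]. *)
pose dl := Num.min (a / 2) (b / 2).
have dl0 : 0 < dl by rewrite lt_min !divr_gt0.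
have cf t : continuous (f \o phi t).
  by move=> x; apply: continuous_comp;
    [exact: (flow_continuous_point phi_flow)|exact: f_cont].
have n1 t : \forall x \near p, `|f (phi t p) - f (phi t x)| < dl.
  by have /cvgrPdist_lt /(_ _ dl0) := @cf t p.
have nc : \forall x \near p, ~ crit A f x.
  apply: open_nbhs_nbhs; split => //; apply: closed_openC; exact: crit_closed f_MB.
exists (V0 `&` ([set x | `|f (phi s p) - f (phi s x)| < dl] `&`
  ([set x | `|f (phi (- s) p) - f (phi (- s) x)| < dl] `&` [set x | ~ crit A f x]))).
  by do 3?[apply: filterI => //]; exact: n1.
exists dl => // x T [Vx [h1 [h2 ncx]]] hT.
apply: (HIV (T, x)); split => //=; apply: HI; rewrite /ball_ /= sub0r normrN.
have dla : dl <= a / 2 by rewrite ge_min lexx.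
have dlb : dl <= b / 2 by rewrite ge_min lexx orbT.
have sr : s < r by rewrite /s; lra.
apply: le_lt_trans sr; rewrite ler_norml; apply/andP; split.
  rewrite leNgt; apply/negP => Ts.
  have := fdec x ncx _ _ (ltW Ts); move: h2 hT dla; rewrite /a.
  by rewrite /= !ltr_norml => /andP[i1 i2] /andP[i3 i4]; lra.
rewrite leNgt; apply/negP => Ts.
have := fdec x ncx _ _ (ltW Ts); move: h1 hT dlb; rewrite /b.
by rewrite /= !ltr_norml => /andP[i1 i2] /andP[i3 i4]; lra.
Qed.

Lemma orbit_trap p (U : set M) : nbhs p U ->
  exists2 V : set M, nbhs p V & exists2 dl : R, 0 < dl &
    forall x T, V x -> `|f (phi T x) - f p| < dl -> U (phi T x).
Proof.
by have [cp|ncp] := pselect (crit A f p); [exact: crit_orbit_trap|exact: regular_orbit_trap].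
Qed.

End KeyLemma.

(** * Chains of orbits *)

Section FlowLimits.
Context {R : realType} {M : topologicalType}.
Variable phi : R -> M -> M.

Definition forward_limit (x p : M) : Prop :=
  forall U, nbhs p U -> exists a, forall t, a < t -> U (phi t x).

Definition backward_limit (x p : M) : Prop :=
  forall U, nbhs p U -> exists a, forall t, t < a -> U (phi t x).

Lemma forward_limitP x p : phi t x @[t --> +oo] --> p <-> forward_limit x p.
Proof.
split=> [H U /H [a [_ Ha]]|H U /H [a Ha]]; first by exists a.
by exists a; split; [exact: num_real|].
Qed.

Lemma backward_limitP x p : phi t x @[t --> -oo] --> p <-> backward_limit x p.
Proof.
split=> [H U /H [a [_ Ha]]|H U /H [a Ha]]; first by exists a.
by exists a; split; [exact: num_real|].
Qed.

Lemma forward_limit_unique x p q : hausdorff_space M ->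
  forward_limit x p -> forward_limit x q -> p = q.
Proof.
move=> HM /forward_limitP h1 /forward_limitP h2.
exact: (cvg_unique HM h1 h2).
Qed.

Lemma backward_limit_unique x p q : hausdorff_space M ->
  backward_limit x p -> backward_limit x q -> p = q.
Proof.
move=> HM /backward_limitP h1 /backward_limitP h2.
exact: (cvg_unique HM h1 h2).
Qed.

Hypothesis phiD : forall s t x, phi (s + t) x = phi s (phi t x).

Lemma forward_limit_shift x p s : forward_limit x p -> forward_limit (phi s x) p.
Proof.
move=> H U /H [a Ha]; exists (a - s) => t at_; rewrite -phiD; apply: Ha.
by rewrite -ltrBlDr.
Qed.

Lemma backward_limit_shift x p s : backward_limit x p -> backward_limit (phi s x) p.
Proof.
move=> H U /H [a Ha]; exists (a - s) => t at_; rewrite -phiD; apply: Ha.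
by rewrite -ltrBrDr.
Qed.

Hypothesis phi_cont : forall t, continuous (phi t).
Hypothesis M_hausdorff : hausdorff_space M.

Lemma forward_limit_fixed x p s : forward_limit x p -> phi s p = p.
Proof.
move=> H; apply: (@forward_limit_unique x) => //.
move=> U /(@phi_cont s p) /H [a Ha]; exists (a + s) => t.
by rewrite -ltrBrDr => /Ha /=; rewrite -phiD addrC subrK.
Qed.

Lemma backward_limit_fixed x p s : backward_limit x p -> phi s p = p.
Proof.
move=> H; apply: (@backward_limit_unique x) => //.
move=> U /(@phi_cont s p) /H [a Ha]; exists (a + s) => t.
by rewrite -ltrBlDr => /Ha /=; rewrite -phiD addrC subrK.
Qed.

End FlowLimits.

(** All that the compactness argument retains of the geometry. [gl_trap] is equicontinuity in the
    level parameter: it bounds the change of f and not the time [T]. *)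
Record gradient_like (R : realType) (M : topologicalType) (Sig : set M)
    (f : M -> R) (phi : R -> M -> M) : Prop := GradientLike {
  gl_hausdorff : hausdorff_space M;
  gl_compact : compact [set: M];
  gl_fun : continuous f;
  gl_flow0 : forall x, phi 0 x = x;
  gl_flowD : forall s t x, phi (s + t) x = phi s (phi t x);
  gl_flow : forall t, continuous (phi t);
  gl_energy : forall x, continuous (fun t => f (phi t x));
  gl_decr : forall x s t, ~ Sig x -> s < t -> f (phi t x) < f (phi s x);
  gl_fixed : forall x t, Sig x -> phi t x = x;
  gl_closed : closed Sig;
  gl_near : forall p, Sig p -> \forall y \near p, Sig y ->
    connected_component Sig p y /\ f y = f p;
  gl_level : forall p q, Sig p -> connected_component Sig p q -> f q = f p;
  gl_trap : forall p U, nbhs p U -> exists2 V : set M, nbhs p V &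
    exists2 dl : R, 0 < dl &
    forall x T, V x -> `|f (phi T x) - f p| < dl -> U (phi T x) }.

Section Orbits.
Context {R : realType} {M : topologicalType}.
Variables (Sig : set M) (f : M -> R) (phi : R -> M -> M).
Hypothesis GL : gradient_like Sig f phi.

Let phi0 := gl_flow0 GL.
Let phiD := gl_flowD GL.

Lemma gl_noncrit x t : ~ Sig x -> ~ Sig (phi t x).
Proof.
move=> ncx cx; apply: ncx; rewrite -(phi0 x) -(addNr t) phiD.
by rewrite (gl_fixed GL (- t) cx).
Qed.

Lemma gl_fixed_crit x : (forall t, phi t x = x) -> Sig x.
Proof.
move=> fx; apply: contrapT => ncx.
by have := gl_decr GL ncx ltr01; rewrite !fx ltxx.
Qed.

Lemma gl_energy_le x s t : s <= t -> f (phi t x) <= f (phi s x).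
Proof.
have [cx|ncx] := pselect (Sig x); first by rewrite !(gl_fixed GL _ cx).
by rewrite le_eqVlt => /predU1P[->//|/(gl_decr GL ncx)/ltW].
Qed.

Lemma gl_near_gt p c : c < f p -> nbhs p [set y | c < f y].
Proof. by move=> cp; exact: (@cvgr_gt _ _ _ _ _ _ (@gl_fun _ _ _ _ _ GL p) _ cp). Qed.

Lemma gl_near_lt p c : f p < c -> nbhs p [set y | f y < c].
Proof. by move=> cp; exact: (@cvgr_lt _ _ _ _ _ _ (@gl_fun _ _ _ _ _ GL p) _ cp). Qed.

(** The value still drops between times [t] and [t + 1]; this makes the inequality strict. *)
Lemma forward_limit_lt x p t : ~ Sig x -> forward_limit phi x p -> f p < f (phi t x).
Proof.
move=> ncx H; apply: (@le_lt_trans _ _ (f (phi (t + 1) x))); last first.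
  by apply: (gl_decr GL ncx); rewrite ltrDl.
rewrite leNgt; apply/negP => fp.
have [a Ha] := H _ (gl_near_gt fp).
have T1 : a < Num.max a (t + 1) + 1 by rewrite ltr_pwDr // le_max lexx.
have T2 : t + 1 <= Num.max a (t + 1) + 1.
  by rewrite ler_wpDr // le_max lexx orbT.
by have := Ha _ T1; rewrite /= ltNge (gl_energy_le _ T2).
Qed.

Lemma backward_limit_lt x p t : ~ Sig x -> backward_limit phi x p -> f (phi t x) < f p.
Proof.
move=> ncx H; apply: (@lt_le_trans _ _ (f (phi (t - 1) x))).
  by apply: (gl_decr GL ncx); rewrite gtrDl oppr_lt0.
rewrite leNgt; apply/negP => fp.
have [a Ha] := H _ (gl_near_lt fp).
have T1 : Num.min a (t - 1) - 1 < a by rewrite ltrBlDr ltr_pwDr // ge_min lexx.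
have T2 : Num.min a (t - 1) - 1 <= t - 1.
  by rewrite lerBlDr ler_wpDr // ge_min lexx orbT.
by have := Ha _ T1; rewrite /= ltNge (gl_energy_le _ T2).
Qed.

Lemma gl_closed_nbhs (p : M) (U : set M) : nbhs p U ->
  exists2 V : set M, nbhs p V & closure V `<=` U.
Proof.
by move=> pU; apply: (compact_regular (gl_hausdorff GL) (gl_compact GL)) => //; exact: filterT.
Qed.

Definition orbit_from_to (O : set M) (p q : M) : Prop :=
  exists x, [/\ O = flow_orbit phi x, ~ Sig x, backward_limit phi x p &
    forward_limit phi x q].

Definition orbit_closure (O : set M) (p q : M) : set M := O `|` [set p; q].

Lemma orbit_from_to_at O p q y : orbit_from_to O p q -> O y ->
  [/\ ~ Sig y, backward_limit phi y p, forward_limit phi y q & forall t, O (phi t y)].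
Proof.
move=> [x [-> ncx xp xq]] [s _ <-]; split.
- exact: gl_noncrit.
- exact: backward_limit_shift.
- exact: forward_limit_shift.
by move=> t; exists (t + s).
Qed.

Lemma orbit_flow O p q y z : orbit_from_to O p q -> O y -> O z ->
  exists t, z = phi t y.
Proof.
move=> [x [-> _ _ _]] [s _ <-] [r _ <-]; exists (r - s).
by rewrite -phiD subrK.
Qed.

Lemma orbit_between O p q y : orbit_from_to O p q -> O y -> f q < f y < f p.
Proof.
move=> Opq Oy; have [ncy yp yq _] := orbit_from_to_at Opq Oy.
by rewrite -{1 2}(phi0 y) forward_limit_lt // backward_limit_lt.
Qed.

Lemma orbit_ends O p q : orbit_from_to O p q -> [/\ Sig p, Sig q & f q < f p].
Proof.
move=> [x [_ ncx xp xq]]; split.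
- by apply: gl_fixed_crit => t; exact: (backward_limit_fixed phiD (gl_flow GL) (gl_hausdorff GL) _ xp).
- by apply: gl_fixed_crit => t; exact: (forward_limit_fixed phiD (gl_flow GL) (gl_hausdorff GL) _ xq).
exact: lt_trans (forward_limit_lt 0 ncx xq) (backward_limit_lt 0 ncx xp).
Qed.

Lemma orbit_inj O p q y z : orbit_from_to O p q -> O y -> O z -> f y = f z -> y = z.
Proof.
move=> Opq Oy Oz; have [t ->] := orbit_flow Opq Oy Oz.
have [ncy _ _ _] := orbit_from_to_at Opq Oy; rewrite -{1}(phi0 y) => e.
have [t0|t0|<-] := ltgtP 0 t; last by rewrite phi0.
  by have := gl_decr GL ncy t0; rewrite e ltxx.
by have := gl_decr GL ncy t0; rewrite e ltxx.
Qed.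

Lemma orbit_surj O p q l : orbit_from_to O p q -> f q < l < f p ->
  exists2 y, O y & f y = l.
Proof.
move=> [x [-> ncx xp xq]] /andP[ql lp].
have [a Ha] := xq _ (gl_near_lt ql).
have [b Hb] := xp _ (gl_near_gt lp).
pose s := Num.min a b - 1; pose t := Num.max a b + 1.
have fs : l < f (phi s x).
  by apply: Hb; rewrite /s; have := ge_min b a b; rewrite lexx orbT; lra.
have ft : f (phi t x) < l.
  by apply: Ha; rewrite /t; have := le_max a a b; rewrite lexx /=; lra.
have st : s <= t.
  rewrite /s /t; have := le_max a a b; have := ge_min a a b.
  by rewrite lexx /=; lra.
have [||r _ <-] := @IVT R (fun t => f (phi t x)) s t l st.
- by apply: continuous_subspaceT; exact: (gl_energy GL).
- by rewrite ge_min le_max (ltW fs) (ltW ft) !orbT.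
by exists (phi r x) => //; exists r.
Qed.

(** Extends the trap to the limit points of an orbit. If [y] is a limit point, a nearby point of the
    orbit replaces it; if [z] is one, it is a limit of trapped points, so the trap is applied to a
    smaller neighbourhood whose closure lies in [U]. *)
Lemma orbit_closure_trap p (U : set M) : nbhs p U ->
  exists2 V : set M, nbhs p V & exists2 dl : R, 0 < dl &
    forall O q r y z, orbit_from_to O q r -> orbit_closure O q r y ->
      orbit_closure O q r z -> V y -> `|f z - f p| < dl -> U z.
Proof.
move=> /gl_closed_nbhs[U' /(gl_trap GL)[V Vp [dl dl0 HV]] U'U].
exists (interior V); first exact: nbhs_interior.
exists dl => // O q r y z Oqr Oy Oz Vy fz; apply: U'U.
have [y' Oy' Vy'] : exists2 y', O y' & V y'.
  have [x [ OE ncx xq xr]] := Oqr.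
  case: Oy => [Oy|[yq|yr]]; first by exists y => //; exact: nbhs_singleton.
    have [a Ha] := xq _ (eq_ind _ (fun y => nbhs y V) Vy _ yq).
    by exists (phi (a - 1) x); [rewrite OE; exists (a - 1)|apply: Ha; lra].
  have [a Ha] := xr _ (eq_ind _ (fun y => nbhs y V) Vy _ yr).
  by exists (phi (a + 1) x); [rewrite OE; exists (a + 1)|apply: Ha; lra].
have [_ yq yr _] := orbit_from_to_at Oqr Oy'.
have nf : nbhs z [set w | `|f w - f p| < dl].
  have /cvgrPdist_lt /(_ (dl - `|f z - f p|)) := @gl_fun _ _ _ _ _ GL z.
  rewrite subr_gt0 => /(_ fz); apply: filterS => w; rewrite ltrBrDr distrC => h.
  by apply: le_lt_trans h; rewrite -(subrKA (f z)) ler_normD.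
case: Oz => [Oz|[zq|zr]].
- have [t zt] := orbit_flow Oqr Oy' Oz.
  by apply: subset_closure; rewrite zt; apply: HV => //; rewrite -zt.
- move=> B nB; rewrite zq in nf nB.
  have [a Ha] := yq _ (filterI nf nB).
  have [h1 h2] := Ha (a - 1) ltac:(by lra).
  by exists (phi (a - 1) y'); split => //; exact: HV.
- move=> B nB; rewrite zr in nf nB.
  have [a Ha] := yr _ (filterI nf nB).
  have [h1 h2] := Ha (a + 1) ltac:(by lra).
  by exists (phi (a + 1) y'); split => //; exact: HV.
Qed.

(** Sigma is compact and f is locally constant on it. *)
Lemma crit_value_isolated (c : R) : exists2 e : R, 0 < e &
  forall s, Sig s -> `|f s - c| < e -> f s = c.
Proof.
have Sc : compact Sig by apply: (subclosed_compact (gl_closed GL) (gl_compact GL)).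
have H : \forall e \near (0 : R)^'+, Sig `<=` [set s | `|f s - c| < e -> f s = c].
  move/compact_near_coveringP/near_covering_withinP : Sc; apply => s Ss.
  have ns := gl_near GL Ss.
  have [fsc|sc] := eqVneq (f s) c.
    exists ([set y | Sig y -> connected_component Sig s y /\ f y = f s], setT).
      by split => //; exact: filterT.
    by move=> [y e'] /= [hy _] Sy _; have [_ ->] := hy Sy.
  have sc0 : 0 < `|f s - c| by rewrite normr_gt0 subr_eq0.
  exists ([set y | Sig y -> connected_component Sig s y /\ f y = f s],
    [set e' | e' < `|f s - c|]).
    by split => //; exact: nbhs_right_lt.
  move=> [y e'] /= [hy he] Sy; have [_ ->] := hy Sy.
  by move=> h; have := lt_trans h he; rewrite ltxx.
have [e [e0 He]] := filter_ex (filterI (nbhs_right_gt (0 : R)) H).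
by exists e => // s Ss; exact: He.
Qed.

(** The image of a broken trajectory from the first point to the second, breaking points included;
    this form allows induction on the number of pieces. *)
Inductive chain : M -> M -> set M -> Prop :=
| chain_orbit O p q : orbit_from_to O p q -> chain p q (orbit_closure O p q)
| chain_cons O p r q B : orbit_from_to O p r -> chain r q B ->
    chain p q (orbit_closure O p r `|` B).

Lemma chain_bounds p q B : chain p q B ->
  [/\ Sig p, Sig q & f q < f p] /\ [/\ B p, B q & forall y, B y -> f q <= f y <= f p].
Proof.
have clb O p' q' y : orbit_from_to O p' q' -> orbit_closure O p' q' y ->
    f q' <= f y <= f p'.
  move=> Oq; have [_ _ qp] := orbit_ends Oq.
  move=> [Oy|[->|->]]; rewrite ?lexx ?(ltW qp) //.
  by have /andP[/ltW -> /ltW ->] := orbit_between Oq Oy.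
elim=> [ O p' q' Oq|O p' r q' B' Oq _ [[Sr Sq qr] [Br Bq HB]]].
  have [h1 h2 h3] := orbit_ends Oq; split; first by [].
  split; [by right; left|by right; right|].
  by move=> y; exact: clb.
have [h1 h2 h3] := orbit_ends Oq; split.
  by split => //; exact: lt_trans h3.
split; [by left; right; left|by right|].
move=> y [/(clb _ _ _ _ Oq)/andP[a1 a2]|/HB/andP[a1 a2]].
  by rewrite a2 (le_trans (ltW qr)).
by rewrite a1 (le_trans a2) // ltW.
Qed.

Lemma orbit_closure_inj O p q y z : orbit_from_to O p q ->
  orbit_closure O p q y -> orbit_closure O p q z -> f y = f z -> y = z.
Proof.
move=> Oq; have [_ _ qp] := orbit_ends Oq.
have bt := orbit_between Oq.
move=> [Oy|[->|->]] [Oz|[->|->]] //; try by [exact: (orbit_inj Oq)].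
- by move: (bt _ Oy) => /andP[_ +] e; rewrite e ltxx.
- by move: (bt _ Oy) => /andP[+ _] e; rewrite e ltxx.
- by move: (bt _ Oz) => /andP[_ +] e; rewrite e ltxx.
- by move=> e; rewrite e ltxx in qp.
- by move: (bt _ Oz) => /andP[+ _] e; rewrite e ltxx.
- by move=> e; rewrite e ltxx in qp.
Qed.

Lemma orbit_closure_ge O p q y : orbit_from_to O p q ->
  orbit_closure O p q y -> f q <= f y /\ (f y = f q -> y = q).
Proof.
move=> Oq Oy; split; last first.
  by apply: (orbit_closure_inj Oq Oy); right; right.
by have [_ [_ _ /(_ y Oy)/andP[]]] := chain_bounds (chain_orbit Oq).
Qed.

(** The first orbit lies above the breaking point [r] and the rest of the chain below it, so a
    common level of the two parts can only be that of [r]. *)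
Lemma chain_inj p q B y z : chain p q B -> B y -> B z -> f y = f z -> y = z.
Proof.
move=> ch; elim: ch y z => {p q B} [ O p q Oq y z|O p r q B Oq ch IH].
  exact: orbit_closure_inj.
have [_ [Br _ HB]] := chain_bounds ch.
have mixed v w : orbit_closure O p r v -> B w -> f v = f w -> v = w.
  move=> Ov Bw vw; have [rv vr] := orbit_closure_ge Oq Ov.
  have /andP[_ wr] := HB _ Bw.
  have fvr : f v = f r by apply/le_anti; rewrite rv vw wr.
  by rewrite vr //; apply: IH; rewrite // -fvr.
move=> y z [Oy|By] [Oz|Bz] yz.
- exact: (orbit_closure_inj Oq Oy Oz yz).
- exact: mixed.
- by apply/esym/mixed.
- exact: IH.
Qed.

Lemma chain_surj p q B l : chain p q B -> f q <= l <= f p ->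
  exists2 y, B y & f y = l.
Proof.
have surj O p' q' : orbit_from_to O p' q' -> f q' <= l <= f p' ->
    exists2 y, orbit_closure O p' q' y & f y = l.
  move=> Oq /andP[]; rewrite le_eqVlt => /predU1P[<- _|ql].
    by exists q' => //; right; right.
  rewrite le_eqVlt => /predU1P[->|lp]; first by exists p' => //; right; left.
  have [|y Oy fy] := orbit_surj (l := l) Oq; first by rewrite ql lp.
  by exists y => //; left.
elim=> {p q B} [ O p q Oq|O p r q B Oq ch IH]; first exact: surj.
move=> /andP[ql lp]; have [lr|rl] := leP l (f r).
  by have [|y By fy] := IH; [rewrite ql lr|exists y => //; right].
by have [|y Oy fy] := surj _ _ _ Oq; [rewrite lp ltW|exists y => //; left].
Qed.

Lemma chain_flow p q B y t : chain p q B -> B y -> ~ Sig y -> B (phi t y).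
Proof.
have flow O p' q' : orbit_from_to O p' q' -> orbit_closure O p' q' y -> ~ Sig y ->
    orbit_closure O p' q' (phi t y).
  move=> Oq; have [Sp Sq _] := orbit_ends Oq.
  by move=> [Oy _|[->|->] //]; left; have [_ _ _] := orbit_from_to_at Oq Oy; exact.
elim=> {p q B} [ O p q Oq|O p r q B Oq ch IH]; first exact: flow.
by move=> [Oy|By] ny; [left; exact: flow|right; exact: IH].
Qed.

Definition same_orbit (y z : M) : Prop := exists O p q,
  [/\ orbit_from_to O p q, orbit_closure O p q y & orbit_closure O p q z].

Lemma same_orbit_sym y z : same_orbit y z -> same_orbit z y.
Proof. by move=> [ O [p [q [h1 h2 h3]]]]; exists O, p, q. Qed.

Lemma same_orbit_refl p q B y : chain p q B -> B y -> same_orbit y y.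
Proof.
elim=> {p q B} [ O p q Oq|O p r q B Oq ch IH]; first by move=> Oy; exists O, p, q.
by move=> [Oy|/IH//]; exists O, p, r.
Qed.

(** A break before [z] would be a critical point strictly below [p] and not below [z]. *)
Lemma chain_head p q B z : chain p q B -> B z ->
  (forall s, Sig s -> f z <= f s <= f p -> f s = f p) -> same_orbit p z.
Proof.
case=> {p q B} [ O p q Oq|O p r q B Oq ch].
  by move=> Oz _; exists O, p, q; split => //; right; left.
move=> [Oz|Bz] H; first by exists O, p, r; split => //; right; left.
have [_ Sr rp] := orbit_ends Oq; have [_ [_ _ /(_ z Bz)/andP[_ zr]]] := chain_bounds ch.
by have := rp; rewrite (H r Sr) ?ltxx // zr ltW.
Qed.

(* A segment of a chain that meets a single critical level passes through at
   most one breaking point. *)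
Lemma chain_two_orbits c p q B y z : chain p q B -> B y -> B z -> f z <= f y ->
  (forall s, Sig s -> f z <= f s <= f y -> f s = c) ->
  exists w, [/\ same_orbit y w, same_orbit w z & f z <= f w <= f y].
Proof.
elim=> {p q B} [ O p q Oq|O p r q B Oq ch IH].
  move=> Oy Oz zy _; exists y; split; try by exists O, p, q.
  by rewrite zy lexx.
have [[Sr _ _] [Br _ HB]] := chain_bounds ch.
move=> [Oy|By] [Oz|Bz] zy H.
- exists y; split; try by exists O, p, r.
  by rewrite zy lexx.
- have [ry _] := orbit_closure_ge Oq Oy; have /andP[_ zr] := HB _ Bz.
  exists r; split; last by rewrite zr ry.
    by exists O, p, r; split => //; right; right.
  have fr := H _ Sr (introT andP (conj zr ry)).
  apply: (chain_head ch Bz) => s Ss /andP[zs sr].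
  by rewrite fr; apply: H => //; rewrite zs (le_trans sr).
- have [rz _] := orbit_closure_ge Oq Oz; have /andP[_ yr] := HB _ By.
  have yz : y = z.
    apply: (chain_inj (chain_cons Oq ch)); [by right|by left|].
    by apply/le_anti; rewrite zy (le_trans yr rz).
  exists y; rewrite -yz lexx; split => //; exact: same_orbit_refl ch By.
- exact: IH.
Qed.

(** The window [e] around [f r] contains no other critical value, so [y] and [z] are joined by at
    most two orbits through some [w]. One trap leads from [V2] to [V1], where [w] lies, the other
    from [V1] to [U]. *)
Lemma chain_trap r (U : set M) : nbhs r U ->
  exists2 V : set M, nbhs r V & exists2 dl : R, 0 < dl &
    forall p q B y z, chain p q B -> B y -> B z -> V y ->
      `|f y - f r| < dl -> `|f z - f r| < dl -> U z.
Proof.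
move=> /orbit_closure_trap[V1 /orbit_closure_trap[V2 V2r [d2 d20 H2]] [d1 d10 H1]].
have [e e0 He] := crit_value_isolated (f r).
exists V2 => //; exists (Num.min e (Num.min d1 d2)); first by rewrite !lt_min e0 d10.
move=> p q B y z ch By Bz Vy; rewrite !lt_min.
move=> /andP[ye /andP[y1 y2]] /andP[ze /andP[z1 z2]].
suff [w [[ O [p1 [q1 [h1 h2 h3]]]] [ Q [p2 [q2 [h4 h5 h6]]]] w2]] :
    exists w, [/\ same_orbit y w, same_orbit w z & `|f w - f r| < d2].
  by apply: (H1 _ _ _ _ _ h4 h5 h6 _ z1); exact: (H2 _ _ _ _ _ h1 h2 h3 Vy w2).
have between (a b w d : R) : `|a - f r| < d -> `|b - f r| < d -> a <= w <= b ->
    `|w - f r| < d.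
  rewrite !ltr_norml => /andP[a1 a2] /andP[b1 b2] /andP[aw wb].
  by apply/andP; split; lra.
have [zy|/ltW yz] := leP (f z) (f y).
  have [|w [h1 h2 h3]] := @chain_two_orbits (f r) _ _ _ _ _ ch By Bz zy.
    by move=> s Ss sb; apply: He => //; exact: between sb.
  by exists w; split => //; exact: between h3.
have [|w [h1 h2 h3]] := @chain_two_orbits (f r) _ _ _ _ _ ch Bz By yz.
  by move=> s Ss sb; apply: He => //; exact: between sb.
exists w; split; [exact: same_orbit_sym|exact: same_orbit_sym|exact: between h3].
Qed.

End Orbits.

(** * Limits of chains *)

Section LimitChain.
Context {R : realType} {M : topologicalType}.
Variables (Sig : set M) (f : M -> R) (phi : R -> M -> M).
Hypothesis GL : gradient_like Sig f phi.
Variables (a b : R) (m : R -> M).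
Hypothesis m_level : forall l, a <= l <= b -> f (m l) = l.
Hypothesis m_cont : forall l U, a <= l <= b -> nbhs (m l) U ->
  exists2 d : R, 0 < d & forall l', a <= l' <= b -> `|l' - l| < d -> U (m l').
Hypothesis m_flow : forall l t, a <= l <= b -> ~ Sig (m l) ->
  a <= f (phi t (m l)) <= b /\ phi t (m l) = m (f (phi t (m l))).

(** [m] is parametrized by the level itself, so as the parameter grows it runs against the flow. *)
Let crit_level (l : R) : Prop := a <= l <= b /\ Sig (m l).

Lemma crit_level_isolated l : exists2 d : R, 0 < d &
  forall l', crit_level l' -> `|l' - l| < d -> l' = l.
Proof.
have [d d0 Hd] := crit_value_isolated GL l.
by exists d => // l' [l'ab /Hd]; rewrite m_level.
Qed.

(** Elements of [D] come arbitrarily close to the supremum, and isolation forces them to equal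
    it. *)
Lemma crit_level_sup (D : set R) : D !=set0 -> D `<=` crit_level -> D (sup D).
Proof.
move=> D0 DC; have ubD : has_ubound D by exists b => l /DC[/andP[]].
have [l0 Dl0] := D0.
have sab : a <= sup D <= b.
  apply/andP; split; last by apply: ge_sup => // l /DC[/andP[]].
  by apply: (le_trans _ (ub_le_sup ubD Dl0)); have [/andP[]] := DC _ Dl0.
have near d : 0 < d -> exists2 l, D l & `|l - sup D| < d.
  move=> d0; have [l Dl sl] := sup_adherent d0 (conj D0 ubD).
  exists l => //; rewrite distrC ger0_norm ?subr_ge0 ?ub_le_sup //.
  by rewrite ltrBlDr addrC -ltrBlDr.
have [d d0 Hd] := crit_level_isolated (sup D).
by have [l Dl ld] := near d d0; rewrite -(Hd l (DC _ Dl) ld).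
Qed.

Lemma crit_level_inf (D : set R) : D !=set0 -> D `<=` crit_level -> D (inf D).
Proof.
move=> D0 DC; have lbD : has_lbound D by exists a => l /DC[/andP[]].
have near d : 0 < d -> exists2 l, D l & `|l - inf D| < d.
  move=> d0; have [l Dl sl] := inf_adherent d0 (conj D0 lbD).
  exists l => //; rewrite ger0_norm ?subr_ge0 ?ge_inf //.
  by rewrite ltrBlDl.
have [d d0 Hd] := crit_level_isolated (inf D).
by have [l Dl ld] := near d d0; rewrite -(Hd l (DC _ Dl) ld).
Qed.

(** The orbit of a point in between follows [m] and, being noncritical, never reaches the levels [l]
    and [l']. Its values are monotone, so it converges at both ends to points of [m]; these are
    fixed, hence critical, and the gap leaves only [m l] and [m l']. *)
Lemma limit_orbit l l' : crit_level l -> crit_level l' -> l' < l ->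
  (forall c, crit_level c -> ~ (l' < c < l)) ->
  exists2 O : set M, orbit_from_to Sig phi O (m l) (m l') &
    forall c, l' < c < l -> O (m c).
Proof.
move=> [lab Sl] [l'ab Sl'] l'l gap.
have /andP[la lb] := lab; have /andP[l'a l'b] := l'ab.
have ab c : l' < c < l -> a <= c <= b.
  by move=> /andP[h1 h2]; rewrite (le_trans l'a (ltW h1)) (le_trans (ltW h2) lb).
pose l0 := (l' + l) / 2.
have l0l : l' < l0 < l by rewrite /l0; apply/andP; split; lra.
have /andP[l'l0 l0l'] := l0l.
have nS c : l' < c < l -> ~ Sig (m c) by move=> h Sc; apply: (gap c) => //; split=> //; exact: ab.
pose x := m l0; have ncx : ~ Sig x := nS _ l0l.
pose h t := f (phi t x).
have hm t : a <= h t <= b /\ phi t x = m (h t) := m_flow t (ab _ l0l) ncx.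
have h0 : h 0 = l0 by rewrite /h (gl_flow0 GL) m_level // ab.
have hc (s t : R) : {within `[s, t], continuous h}.
  by apply: continuous_subspaceT; exact: (gl_energy GL).
have nh t c : Sig (m c) -> h t <> c.
  move=> Sc e; apply: (gl_noncrit GL (t := t) ncx).
  by have [_ ->] := hm t; rewrite e.
(* Leaving the interval would mean crossing a critical level, by the intermediate value theorem. *)
have hb t : l' < h t < l.
  apply/andP; split; rewrite ltNge; apply/negP => ht.
    have t0 : 0 <= t.
      rewrite leNgt; apply/negP => t0; have := gl_energy_le GL x (ltW t0).
      by rewrite -/(h t) -/(h 0) h0 => h1; have := le_trans h1 ht; rewrite leNgt l'l0.
    have [|r _ hr] := @IVT R h 0 t l' t0 (hc _ _); last exact: nh hr.
    by rewrite ge_min le_max ht h0 (ltW l'l0) !orbT.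
  have t0 : t <= 0.
    rewrite leNgt; apply/negP => t0; have := gl_energy_le GL x (ltW t0).
    by rewrite -/(h t) -/(h 0) h0 => h1; have := le_trans ht h1; rewrite leNgt l0l'.
  have [|r _ hr] := @IVT R h t 0 l t0 (hc _ _); last exact: nh hr.
  by rewrite ge_min le_max ht h0 (ltW l0l') !orbT.
have rngE t : range h (h t) by exists t.
have rng0 : range h !=set0 by exists (h 0).
have lbr : has_lbound (range h).
  by exists l' => _ [t _ <-]; have /andP[/ltW] := hb t.
have ubr : has_ubound (range h).
  by exists l => _ [t _ <-]; have /andP[_ /ltW] := hb t.
have lim_crit c : a <= c <= b -> (forall t, phi t (m c) = m c) -> crit_level c.
  by move=> cab fc; split=> //; exact: (gl_fixed_crit GL).
have fw : forward_limit phi x (m (inf (range h))) /\ a <= inf (range h) <= b.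
  have ib : a <= inf (range h) <= b.
    apply/andP; split.
      by apply: lb_le_inf => // _ [t _ <-]; have [/andP[]] := hm t.
    by apply: (le_trans (ge_inf lbr (rngE 0))); have [/andP[]] := hm 0.
  split=> // U /(m_cont ib)[d d0 Hd].
  have [_ [t0 _ <-] ht0] := inf_adherent d0 (conj rng0 lbr).
  exists t0 => t /ltW tt0; have [hab ->] := hm t; apply: Hd => //.
  rewrite ger0_norm ?subr_ge0 ?ge_inf // ltrBlDl.
  by apply: le_lt_trans ht0; exact: (gl_energy_le GL).
have bw : backward_limit phi x (m (sup (range h))) /\ a <= sup (range h) <= b.
  have ib : a <= sup (range h) <= b.
    apply/andP; split.
      by apply: (le_trans _ (ub_le_sup ubr (rngE 0))); have [/andP[]] := hm 0.
    by apply: ge_sup => // _ [t _ <-]; have [/andP[]] := hm t.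
  split=> // U /(m_cont ib)[d d0 Hd].
  have [_ [t0 _ <-] ht0] := sup_adherent d0 (conj rng0 ubr).
  exists t0 => t /ltW tt0; have [hab ->] := hm t; apply: Hd => //.
  rewrite distrC ger0_norm ?subr_ge0 ?ub_le_sup // ltrBlDr addrC -ltrBlDr.
  by apply: (lt_le_trans ht0); exact: (gl_energy_le GL).
have infE : inf (range h) = l'.
  have [fl ib] := fw.
  have ci : crit_level (inf (range h)).
    apply: lim_crit => // t.
    exact: (forward_limit_fixed (gl_flowD GL) (gl_flow GL) (gl_hausdorff GL) t fl).
  have il : inf (range h) < l.
    by apply: (le_lt_trans (ge_inf lbr (rngE 0))); rewrite h0.
  have li : l' <= inf (range h).
    by apply: lb_le_inf => // _ [t _ <-]; have /andP[/ltW] := hb t.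
  apply/eqP; rewrite eq_le li andbT leNgt; apply/negP => li'.
  by apply: (gap _ ci); rewrite li' il.
have supE : sup (range h) = l.
  have [fl ib] := bw.
  have ci : crit_level (sup (range h)).
    apply: lim_crit => // t.
    exact: (backward_limit_fixed (gl_flowD GL) (gl_flow GL) (gl_hausdorff GL) t fl).
  have il : l' < sup (range h).
    by apply: (lt_le_trans _ (ub_le_sup ubr (rngE 0))); rewrite h0.
  have li : sup (range h) <= l.
    by apply: ge_sup => // _ [t _ <-]; have /andP[_ /ltW] := hb t.
  apply/eqP; rewrite eq_le li leNgt; apply/negP => li'.
  by apply: (gap _ ci); rewrite li' il.
rewrite infE in fw; rewrite supE in bw.
have Oo : orbit_from_to Sig phi (flow_orbit phi x) (m l) (m l').
  by exists x; split; [by []|by []|exact: bw.1|exact: fw.1].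
exists (flow_orbit phi x) => // c cl.
have [|y [t _ <-] fy] := orbit_surj GL (l := c) Oo; first by rewrite !m_level.
have [_ e] := hm t; move: fy; rewrite -/(h t) => hc'.
by exists t => //; rewrite e hc'.
Qed.

(** Least counterexample: [k] is the lowest critical level without a chain and [k'] the critical
    level just below it. One orbit leads from [m k] to [m k'], and from there a chain exists unless
    [k'] is already [a]. *)
Lemma limit_chain l : Sig (m a) -> a < l <= b -> Sig (m l) ->
  exists2 B : set M, chain Sig phi (m l) (m a) B &
    forall c, a <= c <= l -> B (m c).
Proof.
move=> Sa alb Sl; apply: contrapT => noB.
have /andP[al lb] := alb.
have ab : a <= b by exact: ltW (lt_le_trans al lb).
have Ca : crit_level a by split; rewrite ?lexx.
pose D : set R := [set l | [/\ a < l <= b, Sig (m l) & ~ exists2 B : set M,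
  chain Sig phi (m l) (m a) B & forall c, a <= c <= l -> B (m c)]].
have DC : D `<=` crit_level.
  by move=> c [/andP[ac cb] Sc _]; split => //; rewrite ltW.
have [|] := @crit_level_inf D _ DC; first by exists l; split => //; rewrite al.
set k := inf D => /andP[ak kb] Sk nk.
pose E : set R := [set c | crit_level c /\ c < k].
have Esup : E (sup E).
  apply: crit_level_sup; first by exists a.
  by move=> c [].
set k' := sup E in Esup; have [Ck' k'k] := Esup.
have ubE : has_ubound E by exists k => c [_ /ltW].
have Ck : crit_level k by split => //; rewrite (ltW ak).
have gap c : crit_level c -> ~ (k' < c < k).
  move=> Cc /andP[k'c ck]; have : c <= k' by apply: ub_le_sup.
  by rewrite leNgt k'c.
have [ O OO HO] := limit_orbit Ck Ck' k'k gap.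
have cl c : k' <= c <= k -> orbit_closure O (m k) (m k') (m c).
  move=> /andP[]; rewrite le_eqVlt => /predU1P[<- _|k'c]; first by right; right.
  rewrite le_eqVlt => /predU1P[->|ck]; first by right; left.
  by left; apply: HO; rewrite k'c ck.
have [/andP[ak' k'b] Sk'] := Ck'.
have [ak'E|nak'] := eqVneq a k'.
  apply: nk; exists (orbit_closure O (m k) (m k')); last by rewrite ak'E.
  by rewrite ak'E; exact: chain_orbit.
have {nak'} ak'' : a < k' by rewrite lt_neqAle nak' ak'.
have [B chB HB] : exists2 B : set M, chain Sig phi (m k') (m a) B &
    forall c, a <= c <= k' -> B (m c).
  apply: contrapT => nB.
  have : k <= k'.
    apply: ge_inf; first by exists a => c [/andP[/ltW]].
    by split => //; rewrite ak'' k'b.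
  by rewrite leNgt k'k.
apply: nk; exists (orbit_closure O (m k) (m k') `|` B); first exact: chain_cons.
move=> c /andP[ac ck]; have [ck'|k'c] := leP c k'.
  by right; apply: HB; rewrite ac.
by left; apply: cl; rewrite ck ltW.
Qed.

End LimitChain.

(** * Compactness *)

Section BrokenTrajectories.
Context {R : realType} {M : topologicalType} {n : nat}.
Variables (A : smooth_structure R M n) (f : M -> R) (phi : R -> M -> M).
Local Notation Sig := (crit A f).
Hypothesis GL : gradient_like Sig f phi.
Local Notation traj := (trajectories A f phi).
Local Notation orbit := (orbit_from_to Sig phi).

Let HM := gl_hausdorff GL.

Lemma orbit_ends_unique O p q p' q' : orbit O p q -> orbit O p' q' ->
  p = p' /\ q = q'.
Proof.
move=> H H'; have [x [Ox _ _ _]] := H.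
have Oxx : O x by rewrite Ox; exists 0 => //; exact: (gl_flow0 GL).
have [_ h1 h2 _] := orbit_from_to_at GL H Oxx.
have [_ h1' h2' _] := orbit_from_to_at GL H' Oxx.
by split; [exact: backward_limit_unique h1 h1'|exact: forward_limit_unique h2 h2'].
Qed.

Lemma flow_orbit_refl x : flow_orbit phi x x.
Proof. by exists 0 => //; exact: (gl_flow0 GL). Qed.

Lemma crit_componentE S p : crit_component A f S -> S p -> S = connected_component Sig p.
Proof. by move=> [x _ ->]; exact: same_connected_component. Qed.

(** The condition [S <> S'] excludes constant orbits: both limits of a critical point are the point
    itself. *)
Lemma trajectory_orbit (O : traj) : orbit (set_val O) (pi_minus O) (pi_plus O).
Proof.
have [y Oy /backward_limitP yp] : start_point phi (set_val O) (pi_minus O).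
  by rewrite /pi_minus; case: cid.
have [z Oz /forward_limitP zq] : end_point phi (set_val O) (pi_plus O).
  by rewrite /pi_plus; case: cid.
have [S [S' [x [cS cS' SS' [[p Sp /backward_limitP xp] [q Sq /forward_limitP xq]] Ox]]]] :
  traj (set_val O) by apply/set_mem; exact: valP.
have [r _ ryx] : flow_orbit phi y x by rewrite -Oy Ox; exact: flow_orbit_refl.
have [s _ szx] : flow_orbit phi z x by rewrite -Oz Ox; exact: flow_orbit_refl.
exists x; split => //; last 2 first.
- by rewrite -ryx; exact: (backward_limit_shift (gl_flowD GL) _ yp).
- by rewrite -szx; exact: (forward_limit_shift (gl_flowD GL) _ zq).
move=> Sx; apply: SS'.
have px : p = x.
  apply: (backward_limit_unique HM xp) => U Ux; exists 0 => t _.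
  by rewrite (gl_fixed GL t Sx); exact: nbhs_singleton.
have qx : q = x.
  apply: (forward_limit_unique HM xq) => U Ux; exists 0 => t _.
  by rewrite (gl_fixed GL t Sx); exact: nbhs_singleton.
by rewrite (crit_componentE cS Sp) (crit_componentE cS' Sq) px qx.
Qed.

(** The two ends lie in different components of Sigma because f is constant on components and
    strictly smaller at [q]. *)
Lemma orbit_trajectory O p q : orbit O p q ->
  exists T : traj, [/\ set_val T = O, pi_minus T = p & pi_plus T = q].
Proof.
move=> H; have [Sp Sq qp] := orbit_ends GL H.
have [x [Ox ncx xp xq]] := H.
have TO : traj O.
  exists (connected_component Sig p), (connected_component Sig q), x; split => //.
  - by exists p.
  - by exists q.
  - move=> e; have : connected_component Sig p q.
      by rewrite e; exact: connected_component_refl.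
    by move=> /(gl_level GL Sp) fe; rewrite fe ltxx in qp.
  - split; [exists p; last exact/backward_limitP|exists q; last exact/forward_limitP];
      exact: connected_component_refl.
pose T : traj := exist _ O (mem_set TO); exists T.
have TE : set_val T = O by [].
have [h1 h2] := orbit_ends_unique (trajectory_orbit T) H.
by split.
Qed.

(** * Broken trajectories as chains *)

Definition pieces_image k (tau : 'I_k.+1 -> traj) : set M :=
  \bigcup_(i in [set: 'I_k.+1])
    (set_val (tau i) `|` [set pi_minus (tau i); pi_plus (tau i)]).

Lemma pieces_image_recl k (tau : 'I_k.+2 -> traj) :
  pieces_image tau = (set_val (tau ord0) `|` [set pi_minus (tau ord0); pi_plus (tau ord0)])
    `|` pieces_image (fun i : 'I_k.+1 => tau (lift ord0 i)).
Proof.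
rewrite predeqE => y; split.
  move=> [i _ Hi]; case: (unliftP ord0 i) Hi => [j ->|->] Hi; last by left.
  by right; exists j.
by move=> [H|[j _ H]]; [exists ord0|exists (lift ord0 j)].
Qed.

Lemma pieces_chain k (tau : 'I_k.+1 -> traj) :
  broken_trajectories_k tau ->
  chain Sig phi (pi_minus (tau ord0)) (pi_plus (tau ord_max)) (pieces_image tau).
Proof.
elim: k tau => [|k IH] tau H.
  have -> : pieces_image tau =
      orbit_closure (set_val (tau ord0)) (pi_minus (tau ord0)) (pi_plus (tau ord0)).
    rewrite predeqE => y; split; last by exists ord0.
    by move=> [i _]; rewrite (ord1 i).
  have -> : ord_max = ord0 :> 'I_1 by apply: val_inj.
  exact/chain_orbit/trajectory_orbit.
rewrite pieces_image_recl.
have -> : ord_max = lift ord0 ord_max :> 'I_k.+2 by apply: val_inj.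
apply: (chain_cons (trajectory_orbit (tau ord0))).
have -> : pi_plus (tau ord0) = pi_minus (tau (lift ord0 ord0)).
  by rewrite -(H ord0); congr (pi_plus (tau _)); apply: val_inj.
apply: (IH (fun i => tau (lift ord0 i))) => i /=.
rewrite -(H (lift ord0 i)); congr (pi_plus (tau _)).
exact: val_inj.
Qed.

Lemma broken_chain (tau : broken_trajectory A f phi) :
  chain Sig phi (hat_pi_minus tau) (hat_pi_plus tau) (broken_image tau).
Proof.
case: tau => k tau; have H : broken_trajectories_k (set_val tau).
  by apply/set_mem; exact: valP.
exact: (pieces_chain H).
Qed.

Lemma chain_pieces p q B : chain Sig phi p q B ->
  exists k (tau : 'I_k.+1 -> traj), [/\ broken_trajectories_k tau,
    pi_minus (tau ord0) = p, pi_plus (tau ord_max) = q & pieces_image tau = B].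
Proof.
elim=> {p q B} [ O p q /orbit_trajectory[T [TO Tp Tq]]|
               O p r q B /orbit_trajectory[T [TO Tp Tq]] _ [k [tau [H t0 tm tB]]]].
  exists 0%N, (fun=> T); split => //; first by case.
  rewrite predeqE => y; rewrite /pieces_image TO Tp Tq; split; first by case.
  by exists ord0.
(* The tuple [tau] with [T] put in front: index 0 gives [T], and [lift ord0 j] gives [tau j]. *)
exists k.+1, (fun i => oapp tau T (unlift ord0 i)); split.
- move=> i; case: (unliftP ord0 i) => [j ij|i0].
    have -> : widen_ord (leqnSn k.+1) i = lift ord0 (widen_ord (leqnSn k) j).
      by apply: val_inj; rewrite /= ij.
    rewrite !liftK /= ij H; congr (pi_minus (tau _)).
  rewrite liftK /= i0.
  have -> : widen_ord (leqnSn k.+1) ord0 = ord0 by apply: val_inj.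
  by rewrite unlift_none /= Tq t0.
- by rewrite unlift_none.
- have -> : ord_max = lift ord0 ord_max :> 'I_k.+2 by apply: val_inj.
  by rewrite liftK.
rewrite pieces_image_recl unlift_none /= TO Tp Tq -tB; congr (_ `|` _).
by congr (pieces_image _); apply/funext => i; rewrite liftK.
Qed.

Lemma chain_broken p q B : chain Sig phi p q B ->
  exists tau : broken_trajectory A f phi,
    [/\ hat_pi_minus tau = p, hat_pi_plus tau = q & broken_image tau = B].
Proof.
move=> /chain_pieces[k [tau [H h1 h2 h3]]].
by exists (existT _ k (exist _ tau (mem_set H))).
Qed.

(** * Paths parametrized by the level *)

Lemma level_component p : Sig p -> level f (connected_component Sig p) = f p.
Proof.
move=> Sp; rewrite /level.
have [|q pq <-] := @getPex R (f @` connected_component Sig p).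
  by exists (f p), p => //; exact: connected_component_refl.
exact: (gl_level GL Sp pq).
Qed.

(** [broken_path] freed from its dependent domain: indexed by the level and defined for every real
    [l], so that limits can be taken one level at a time. *)
Definition broken_point (tau : broken_trajectory A f phi) (l : R) : M :=
  xget (hat_pi_minus tau) [set y | broken_image tau y /\ f y = l].

Lemma broken_pointP tau l : f (hat_pi_plus tau) <= l <= f (hat_pi_minus tau) ->
  broken_image tau (broken_point tau l) /\ f (broken_point tau l) = l.
Proof.
move=> /(chain_surj GL (broken_chain tau))[y By fy].
have : [set y | broken_image tau y /\ f y = l] (broken_point tau l).
  by apply: xgetPex; exists y.
by [].
Qed.

(** The summand [SS] is fixed independently of [tau], so that paths of different trajectories live
    in the same function space. *)
Definition level_path (SS : set M * set M) (tau : broken_trajectory A f phi) :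
    path_interval f SS -> M :=
  fun t => broken_point tau (level f SS.2 + level f SS.1 - set_val t).

Lemma to_path_spaceE tau SS : end_components tau = SS ->
  to_path_space tau = existT _ SS (level_path (SS := SS) tau) :> path_space f.
Proof. by move=> <-. Qed.

Lemma compact_ultra_limit (T : Type) (F : set_system T) (h : T -> M) :
  UltraFilter F -> exists p : M, h x @[x --> F] --> p.
Proof.
move=> FU; have PF : ProperFilter (h @ F) by exact: fmap_proper_filter.
have hT : (h @ F) setT by exact: filterT.
have [p [_ Hp]] := gl_compact GL PF hT.
exists p => U Up; have [//|FnU] := in_ultra_setVsetC (h @^-1` U) FU.
by have [x [/= h1 h2]] := Hp (~` U) U FnU Up.
Qed.

(** * The limit of an ultrafilter of broken trajectories *)

Section ultrafilter.
Variable F : set_system (broken_trajectory A f phi).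
Hypothesis FU : UltraFilter F.
Variables (pm pp : M) (m : R -> M).
Hypothesis pm_lim : hat_pi_minus tau @[tau --> F] --> pm.
Hypothesis pp_lim : hat_pi_plus tau @[tau --> F] --> pp.
Hypothesis m_lim : forall l, broken_point tau l @[tau --> F] --> m l.

Lemma limit_start_crit : Sig pm.
Proof.
apply: (closed_cvg (F := F) _ (gl_closed GL)) pm_lim.
by apply: filterE => tau; have [[]] := chain_bounds GL (broken_chain tau).
Qed.

Lemma limit_end_crit : Sig pp.
Proof.
apply: (closed_cvg (F := F) _ (gl_closed GL)) pp_lim.
by apply: filterE => tau; have [[]] := chain_bounds GL (broken_chain tau).
Qed.

Let SS : set M * set M := (connected_component Sig pm, connected_component Sig pp).

(** Near the limit ends, critical points belong to the same component and have the same value; so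
    the ultrafilter lives in a single summand of the path space. *)
Lemma near_ends : \forall tau \near F, [/\ end_components tau = SS,
  f (hat_pi_minus tau) = f pm & f (hat_pi_plus tau) = f pp].
Proof.
have h1 : \forall tau \near F, Sig (hat_pi_minus tau) ->
    connected_component Sig pm (hat_pi_minus tau) /\ f (hat_pi_minus tau) = f pm.
  exact: (pm_lim (gl_near GL limit_start_crit)).
have h2 : \forall tau \near F, Sig (hat_pi_plus tau) ->
    connected_component Sig pp (hat_pi_plus tau) /\ f (hat_pi_plus tau) = f pp.
  exact: (pp_lim (gl_near GL limit_end_crit)).
apply: filterS2 h1 h2 => tau {}h1 {}h2.
have [[Sm Sp _] _] := chain_bounds GL (broken_chain tau).
have [c1 e1] := h1 Sm; have [c2 e2] := h2 Sp.
by split => //; rewrite /end_components -(same_connected_component c1)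
  -(same_connected_component c2).
Qed.

Let a := f pp.
Let b := f pm.

Lemma near_point l : a <= l <= b -> \forall tau \near F,
  broken_image tau (broken_point tau l) /\ f (broken_point tau l) = l.
Proof.
move=> lab; apply: filterS near_ends => tau [_ e1 e2].
by apply: broken_pointP; rewrite e1 e2.
Qed.

Lemma limit_ab : a < b.
Proof.
have [tau [_ e1 e2]] := filter_ex near_ends.
by have [[_ _ +] _] := chain_bounds GL (broken_chain tau); rewrite e1 e2.
Qed.

Lemma limit_level l : a <= l <= b -> f (m l) = l.
Proof.
move=> lab; apply: (@cvg_unique R _ (f (broken_point tau l) @[tau --> F])).
- exact: Rhausdorff.
- exact: (@cvg_comp _ _ _ _ f _ _ _ (m_lim (l := l)) (@gl_fun _ _ _ _ _ GL (m l))).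
have H : (fun=> l : R) @ F --> l by exact: cvg_cst.
apply: cvg_trans H; apply: near_eq_cvg.
by apply: filterS (near_point lab) => tau [_ ->].
Qed.

(** Convergence at the single level [l] controls all nearby levels, with a [d] that does not depend
    on [tau]: this upgrades pointwise convergence to local uniformity. *)
Lemma limit_trap l U : a <= l <= b -> nbhs (m l) U ->
  exists2 d : R, 0 < d & \forall tau \near F, forall l', a <= l' <= b ->
    `|l' - l| < d -> U (broken_point tau l').
Proof.
move=> lab /(chain_trap GL)[V Vm [d d0 H]]; exists d => //.
have hV : \forall tau \near F, V (broken_point tau l) by exact: (m_lim Vm).
apply: filterS3 hV (near_point lab) near_ends => tau Vt [Bl fl] [_ e1 e2].
move=> l' l'ab l'd.
have [Bl' fl'] : broken_image tau (broken_point tau l') /\ f (broken_point tau l') = l'.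
  by apply: broken_pointP; rewrite e1 e2.
apply: (H _ _ _ _ _ (broken_chain tau) Bl Bl' Vt).
- by rewrite fl (limit_level lab) subrr normr0.
- by rewrite fl' (limit_level lab).
Qed.

Lemma limit_cont l U : a <= l <= b -> nbhs (m l) U ->
  exists2 d : R, 0 < d & forall l', a <= l' <= b -> `|l' - l| < d -> U (m l').
Proof.
move=> lab /(gl_closed_nbhs GL)[V Vm VU].
have [d d0 H] := limit_trap lab Vm; exists d => // l' l'ab l'd; apply: VU.
apply: (closed_cvg (F := F) _ (@closed_closure _ V)) (m_lim (l := l')).
by apply: filterS H => tau H; apply/subset_closure/H.
Qed.

(** The flowed point stays on [tau] and tends to [phi t (m l)]. Its level only tends to that of the
    limit, so it is compared by [chain_trap] with the point of [tau] at exactly the limit level. *)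
Lemma limit_flow l t : a <= l <= b -> ~ Sig (m l) ->
  a <= f (phi t (m l)) <= b /\ phi t (m l) = m (f (phi t (m l))).
Proof.
move=> lab nS.
have nSt : \forall tau \near F, ~ Sig (broken_point tau l).
  have nm : nbhs (m l) (~` Sig).
    by apply: open_nbhs_nbhs; split => //; apply: closed_openC; exact: gl_closed GL.
  exact: (m_lim nm).
have Bt : \forall tau \near F, broken_image tau (phi t (broken_point tau l)).
  apply: filterS2 nSt (near_point lab) => tau nSt [Bl _].
  exact: (chain_flow GL t (broken_chain tau)).
have pl : phi t (broken_point tau l) @[tau --> F] --> phi t (m l).
  exact: (@cvg_comp _ _ _ _ (phi t) _ _ _ (m_lim (l := l)) (@gl_flow _ _ _ _ _ GL t (m l))).
have fl : f (phi t (broken_point tau l)) @[tau --> F] --> f (phi t (m l)).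
  exact: (@cvg_comp _ _ _ _ f _ _ _ pl (@gl_fun _ _ _ _ _ GL (phi t (m l)))).
have Iab : a <= f (phi t (m l)) <= b.
  have hab : \forall tau \near F, a <= f (phi t (broken_point tau l)) <= b.
    apply: filterS2 Bt near_ends => tau Bl [_ e1 e2].
    by have [_ [_ _ /(_ _ Bl)]] := chain_bounds GL (broken_chain tau); rewrite e1 e2.
  apply/andP; split.
    apply: (@closed_cvg _ _ F _ _ [set x | a <= x] (@closed_ge R a) _ _ fl).
    by apply: filterS hab => tau /andP[].
  apply: (@closed_cvg _ _ F _ _ [set x | x <= b] (@closed_le R b) _ _ fl).
  by apply: filterS hab => tau /andP[].
split=> //; set r := phi t (m l) in pl fl Iab *.
apply: (@cvg_unique M _ (broken_point tau (f r) @[tau --> F])); last exact: m_lim.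
  exact: HM.
move=> U /(chain_trap GL)[V Vr [d d0 H]].
have fd : \forall tau \near F, `|f (phi t (broken_point tau l)) - f r| < d.
  have /cvgrPdist_lt /(_ _ d0) := fl.
  by apply: filterS => tau; rewrite distrC.
have hV : \forall tau \near F, V (phi t (broken_point tau l)) by exact: (pl _ Vr).
have hB := near_point Iab.
apply: filterS2 (filterI hV fd) (filterI Bt hB) => tau [Vt fdt] [Bl [Br fr]].
by apply: (H _ _ _ _ _ (broken_chain tau) Bl Br Vt fdt); rewrite fr subrr normr0.
Qed.

Lemma limit_start : m b = pm.
Proof.
apply: (cvg_unique HM (m_lim (l := b))).
apply: cvg_trans pm_lim; apply: near_eq_cvg.
have bab : a <= b <= b by rewrite lexx ltW // limit_ab.
apply: filterS2 (near_point bab) near_ends => tau [Bl fl] [_ e1 e2].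
have [_ [Bm _ _]] := chain_bounds GL (broken_chain tau).
by apply: (chain_inj GL (broken_chain tau)); rewrite // fl e1.
Qed.

Lemma limit_end : m a = pp.
Proof.
apply: (cvg_unique HM (m_lim (l := a))).
apply: cvg_trans pp_lim; apply: near_eq_cvg.
have aab : a <= a <= b by rewrite lexx ltW // limit_ab.
apply: filterS2 (near_point aab) near_ends => tau [Bl fl] [_ e1 e2].
have [_ [_ Bm _]] := chain_bounds GL (broken_chain tau).
by apply: (chain_inj GL (broken_chain tau)); rewrite // fl e2.
Qed.

Lemma limit_broken_trajectory : exists tau0 : broken_trajectory A f phi,
  end_components tau0 = SS /\
  forall l, a <= l <= b -> broken_point tau0 l = m l.
Proof.
have ab := limit_ab.
have [|||B chB HB] := limit_chain GL limit_level limit_cont limit_flow (l := b).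
- by rewrite limit_end; exact: limit_end_crit.
- by rewrite ab lexx.
- by rewrite limit_start; exact: limit_start_crit.
rewrite limit_start limit_end in chB.
have [tau0 [h1 h2 h3]] := chain_broken chB.
exists tau0; split; first by rewrite /end_components h1 h2.
move=> l lab.
have [Bl fl] : broken_image tau0 (broken_point tau0 l) /\ f (broken_point tau0 l) = l.
  by apply: broken_pointP; rewrite h1 h2.
rewrite h3 in Bl.
by apply: (chain_inj GL chB) => //; [exact: HB|rewrite fl limit_level].
Qed.

End ultrafilter.

Lemma path_level SS (t : path_interval f SS) :
  level f SS.2 <= level f SS.2 + level f SS.1 - set_val t <= level f SS.1.
Proof.
have : path_interval f SS (set_val t) by apply/set_mem; exact: valP.
by rewrite /path_interval /= in_itv /= => /andP[h1 h2]; apply/andP; split; lra.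
Qed.

(** Compact-open convergence from its local form: finitely many of the neighbourhoods given by the
    hypothesis cover [K]. *)
Lemma broken_path_cvg (F : set_system (broken_trajectory A f phi)) SS
    (tau0 : broken_trajectory A f phi) :
  Filter F ->
  (forall l U, level f SS.2 <= l <= level f SS.1 -> nbhs (broken_point tau0 l) U ->
    exists2 d : R, 0 < d & \forall tau \near F, forall l',
      level f SS.2 <= l' <= level f SS.1 -> `|l' - l| < d ->
      U (broken_point tau l')) ->
  (@level_path SS tau : {compact-open, path_interval f SS -> M}) @[tau --> F] -->
  (@level_path SS tau0 : {compact-open, path_interval f SS -> M}).
Proof.
move=> FF H; apply/compact_open_cvgP => K O cK oO KO.
have /compact_near_coveringP cvr := cK.
suff : \forall tau \near F, K `<=` (fun t => O (@level_path SS tau t)).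
  by apply: filterS => tau HK _ [t Kt <-]; exact: HK.
apply: cvr => t Kt.
have nO : nbhs (@level_path SS tau0 t) O.
  by apply: open_nbhs_nbhs; split => //; apply: KO; exists t.
have [d d0 Hd] := H _ _ (path_level t) nO.
exists ([set t' : path_interval f SS | `|set_val t' - set_val t| < d],
  [set tau | forall l', level f SS.2 <= l' <= level f SS.1 ->
    `|l' - (level f SS.2 + level f SS.1 - set_val t)| < d -> O (broken_point tau l')]).
  split => //=.
  have cv : {for t, continuous (set_val : path_interval f SS -> R)}.
    exact: initial_continuous.
  have /cvgrPdist_lt /(_ _ d0) := cv.
  by apply: filterS => t'; rewrite distrC.
move=> [t' tau] /= [td Htau]; apply: Htau; first exact: path_level.
have -> : level f SS.2 + level f SS.1 - set_val t' -
    (level f SS.2 + level f SS.1 - set_val t) = set_val t - set_val t' by ring.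
by rewrite distrC.
Qed.

(** Along an ultrafilter the ends, and the point at each single level, converge simply because M is
    compact. *)
Theorem broken_trajectories_compact : compact [set: broken_trajectory_space A f phi].
Proof.
rewrite compact_ultra => F FU _.
have [pm pm_lim] := compact_ultra_limit (@hat_pi_minus _ _ _ A f phi) FU.
have [pp pp_lim] := compact_ultra_limit (@hat_pi_plus _ _ _ A f phi) FU.
have /choice[m m_lim] : forall l : R, exists p : M,
    broken_point (tau : broken_trajectory A f phi) l @[tau --> F] --> p.
  by move=> l; exact: (compact_ultra_limit (fun tau => broken_point tau l) FU).
have [tau0 [E0 P0]] := limit_broken_trajectory FU pm_lim pp_lim m_lim.
have nE := near_ends FU pm_lim pp_lim.
have ml := limit_trap FU pm_lim pp_lim m_lim.
(* A neighbourhood in the initial topology contains the preimage of an open [C] of the path space;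
   as almost all [tau] have end components [SS], only that summand has to be examined. *)
exists tau0; split => // U [B [[C oC CB] Bt] BU].
set SS := (_, _) in E0 nE.
have L1 : level f SS.1 = f pm.
  exact: level_component (limit_start_crit FU pm_lim).
have L2 : level f SS.2 = f pp.
  exact: level_component (limit_end_crit FU pp_lim).
have cvg0 : (@level_path SS tau : {compact-open, path_interval f SS -> M}) @[tau --> F]
    --> (@level_path SS tau0 : {compact-open, path_interval f SS -> M}).
  apply: broken_path_cvg => l V; rewrite L1 L2 => lab; rewrite (P0 l lab).
  exact: ml.
have nC : nbhs (@level_path SS tau0 : {compact-open, path_interval f SS -> M})
    [set s | C (existT _ SS s)].
  have : nbhs (to_path_space tau0) C.
    by apply: open_nbhs_nbhs; split => //; rewrite -CB in Bt.
  by rewrite (to_path_spaceE E0).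
have FC : \forall tau \near F, C (existT _ SS (@level_path SS tau)).
  exact: (cvg0 _ nC).
apply: filterS2 FC nE => tau Ct [Et _ _]; apply: BU; rewrite -CB /=.
by rewrite (to_path_spaceE Et).
Qed.

End BrokenTrajectories.

Theorem proposition2 (R : realType) (n : nat) (M : topologicalType)
    (A : smooth_structure R M n)
    (f : M -> R) (g : M -> 'rV[R]_n -> 'rV[R]_n -> R)
    (X : M -> 'rV[R]_n) (phi : R -> M -> M)
    (M_compact : compact [set: M]) (M_hausdorff : hausdorff_space M)
    (f_smooth : smooth_fun A f) (g_metric : riemannian_metric A g)
    (X_grad : is_gradient A g f (fun x => - X x))
    (phi_flow : is_flow A X phi)
    (fg_MBS : morse_bott_smale A f phi g) :
  compact [set: broken_trajectory_space A f phi].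
Proof.
have [f_MB _ _] := fg_MBS.
apply: broken_trajectories_compact; split => //.
- exact: smooth_fun_continuous f_smooth.
- exact: flow0 phi_flow.
- exact: flowD phi_flow.
- exact: flow_continuous_point phi_flow.
- exact: energy_continuous f_smooth g_metric X_grad phi_flow.
- exact: energy_decr f_smooth g_metric X_grad phi_flow.
- by move=> x t cx; exact: (crit_fixed f_smooth g_metric X_grad phi_flow t cx).
- exact: crit_closed f_MB.
- by move=> p; exact: (crit_component_near f_smooth g_metric X_grad f_MB).
- by move=> p q; exact: (component_level f_smooth g_metric X_grad f_MB).
- by move=> p U; exact: (orbit_trap M_hausdorff f_smooth g_metric X_grad phi_flow f_MB).
Qed.
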